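(* The sequence of symmetric groups $\{Sym_n\}_{n\ge 1}$ exhibits Mixed-$L_1$ behavior: there exist two sequences of generating sets $S_n \subset Sym_n$ and $S_n' \subset Sym_n$ ($n \ge 1$) with $\sup_n |S_n| < \infty$ and $\sup_n |S_n'| < \infty$ such that $$\sup_n c_1(Sym_n, d_{S_n}) < \infty \qquad\text{and}\qquad \sup_n c_1(Sym_n, d_{S_n'}) = \infty .$$
   Context: $Sym_n$ is the symmetric group on $n$ letters. For a finite group $G$ with generating set $S$, $d_S$ is the word metric, i.e. the shortest path metric on the Cayley graph of $G$ with respect to $S$ (edges joining $g$ to $sg$ for $s\in S$, viewed as undirected). For a metric space $(M,d)$, $c_1(M,d)$ is the infimum of all $D> 1$ for which there is a map $f : M \to L_1$ with $d(x,y) \le \|f(x)-f(y)\|_1 \le D\, d(x,y)$ for all $x,y\in M$. *)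

(* Defs.v *)
From HB Require Import structures.
From mathcomp Require Import all_boot all_order all_algebra all_fingroup.
From mathcomp Require Import all_classical all_reals all_analysis.

Set Implicit Arguments.
Unset Strict Implicit.
Unset Printing Implicit Defensive.

Import Order.TTheory GRing.Theory Num.Theory.

Local Open Scope classical_set_scope.
Local Open Scope ring_scope.

Definition cayley_edge (gT : finGroupType) (S : {set gT}) : rel gT :=
  fun g h => [exists s in S, (h == s * g)%g || (g == s * h)%g].

(* Vertices in different components get distance 0 = inf set0. For a Cayley
   graph this never happens when S generates the group. *)
Definition path_metric (R : realType) (T : eqType) (e : rel T) (x y : T) : R :=
  inf [set (size p)%:R | p in [set p : seq T | path e x p /\ last x p = y]].

Definition word_metric (R : realType) (gT : finGroupType) (S : {set gT}) :
  gT -> gT -> R := path_metric R (cayley_edge S).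

(* Lebesgue measure on [0, 1], so that L1 below is L_1([0, 1]). *)
Definition mu01 (R : realType) : {measure set measurableTypeR R -> \bar R} :=
  mrestr (@lebesgue_measure R) (@measurable_itv R `[0, 1]).

Definition L1 (R : realType) : Type := LspaceType1 (@mu01 R).

(* Elements of L1 are classes modulo a.e. equality; f \- g is the difference of
   their canonical representatives. *)
Definition L1_dist (R : realType) (f g : L1 R) : \bar R :=
  'N[@mu01 R]_1[EFin \o (f \- g)].

Definition c1 (R : realType) (M : Type) (d : M -> M -> R) : \bar R :=
  ereal_inf [set D%:E | D in [set D : R | 1 < D /\
    exists f : M -> L1 R, forall x y : M,
      ((d x y)%:E <= L1_dist (f x) (f y) /\
       L1_dist (f x) (f y) <= (D * d x y)%:E)%E]].

(* Main.v *)
Require Import Defs.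
From HB Require Import structures.
From mathcomp Require Import all_boot all_order all_algebra all_fingroup.
From mathcomp Require Import all_classical all_reals all_analysis.
From mathcomp Require Import measurable_realfun.
From mathcomp Require Import zify ring lra.

(** Bounded distortion. Take the generators c = (0 1 ... n-1) and t = (0 1). A
    permutation is a cyclic arrangement of n tokens with a cursor, c moves the
    cursor and t swaps the two tokens next to it. Cutting the circle at a token j
    gives a cursor moving on a line. Two such linear states are joined by gnome
    sort in a number of moves comparable to the number of inversions between them
    plus the length of the interval that the cursor has to visit. The inversions
    are a sum of cut semimetrics, and so is the interval length, since it is a
    sum of two tree metrics as for a lamplighter group over the line. A generator
    changes the sum attached to j by O(1), except for O(1) values of j, where it
    changes it by O(n). Averaging over j therefore gives an embedding with
    bounded distortion.

    Unbounded distortion. Let n = |A| for A = (F_2^k)^2, so that A is a subgroup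
    of Sym_n acting by translations. Add to the generators above four shears of
    A (by 1 and by the shift of F_2^k) and two translations; for other n keep
    the generators above. Along the dual shears the Walsh transform of a
    function on Sym_n loses mass, by the Schur test with a weight that is
    superharmonic away from the characters detected by the two translations.
    This yields a Poincare inequality relative to A for real functions, hence
    for cuts, hence for maps into L_1. As a ball of radius l has at most 17^l
    elements, most translations have length of order log |A|, so the distortion
    is at least of that order. *)

Set Implicit Arguments.
Unset Strict Implicit.
Unset Printing Implicit Defensive.

Import Order.TTheory GRing.Theory Num.Theory.

Local Open Scope ring_scope.

(** * Words in a Cayley graph *)

Definition reach (gT : finGroupType) (S : {set gT}) (m : nat) (x y : gT) :=
  exists p, [/\ path (cayley_edge S) x p, last x p = y & (size p <= m)%N].

Section Reach.
Variables (gT : finGroupType) (S : {set gT}).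
Implicit Types (x y z s : gT) (m : nat).

Lemma cayley_edge_sym x y : cayley_edge S x y = cayley_edge S y x.
Proof. by apply/eq_existsb => s; rewrite orbC. Qed.

Lemma cayley_edgeM x y z : cayley_edge S (x * z)%g (y * z)%g = cayley_edge S x y.
Proof. by apply/eq_existsb => s; rewrite !mulgA !(inj_eq (mulIg z)). Qed.

Lemma cayley_edge_gen s x : s \in S -> cayley_edge S x (s * x)%g.
Proof. by move=> sS; apply/existsP; exists s; rewrite sS eqxx. Qed.

Lemma reach0 x : reach S 0 x x.
Proof. by exists [::]. Qed.

Lemma reachW m n x y : (m <= n)%N -> reach S m x y -> reach S n x y.
Proof. by move=> mn [p [? ? pm]]; exists p; split=> //; apply: leq_trans mn. Qed.

Lemma reach_trans m n x y z :
  reach S m x y -> reach S n y z -> reach S (m + n) x z.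
Proof.
move=> [p [xp yE pm]] [q [yq zE qn]]; exists (p ++ q).
by rewrite cat_path last_cat xp yE yq zE size_cat leq_add.
Qed.

Lemma reach_edge x y : cayley_edge S x y -> reach S 1 x y.
Proof. by move=> xy; exists [:: y]; rewrite /= xy. Qed.

Lemma reachM m x y z : reach S m x y -> reach S m (x * z)%g (y * z)%g.
Proof.
move=> [p [xp yE pm]]; exists (map (fun w => (w * z)%g) p).
rewrite size_map (last_map (fun w => (w * z)%g)) yE; split=> //.
by elim: p x xp {yE pm} => //= w p IH x /andP[xw /IH ->]; rewrite cayley_edgeM xw.
Qed.

Lemma reach_mem_gen m x : reach S m 1%g x -> x \in <<S>>%g.
Proof.
move=> [p [+ <- _]] {x}; elim: p 1%g (group1 <<S>>) => //= y p IH x xS.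
case/andP=> /existsP[s /andP[sS xy]]; apply: IH.
have {}sS : s \in <<S>>%g by apply: mem_gen.
by case/orP: xy xS => /eqP-> xS; [apply: groupM | rewrite groupMl in xS].
Qed.

End Reach.

(** * Sorting a cyclic arrangement with a cursor *)

Section CyclicArrangements.
Variable m : nat.
Local Notation I := 'I_m.+1.
Local Notation G := 'S_m.+1.
Implicit Types (i j k l : I) (g h s : G).

Definition cyc_one : I := inZp 1.
Local Notation o := cyc_one.

Lemma rot_subproof k : injective (fun i : I => i + k).
Proof. exact: addIr. Qed.

Definition rotation k : G := perm (@rot_subproof k).

Definition adjacent_swap : G := tperm 0 o.

Definition cyclic_gens : {set G} := [set rotation o; adjacent_swap].

Lemma rotationE k i : rotation k i = i + k.
Proof. by rewrite permE. Qed.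

Lemma rotationD k l : rotation (k + l) = (rotation k * rotation l)%g.
Proof. by apply/permP=> i; rewrite permM !rotationE addrA. Qed.

Lemma rotation0 : rotation 0 = 1%g.
Proof. by apply/permP=> i; rewrite rotationE perm1 addr0. Qed.

Lemma rotationV k : (rotation k)^-1%g = rotation (- k).
Proof. by apply/eqP; rewrite eq_invg_mul -rotationD subrr rotation0. Qed.

Lemma eq_ordE i j : (i == j) = (i == j :> nat).
Proof. by []. Qed.

Lemma val_addo k : (k < m)%N -> k + o = k.+1 :> nat.
Proof. by move=> km; rewrite /= modnDmr addn1 modn_small. Qed.

(** In a product the left factor acts first, so [rotation k * s] is the arrangement [s] with the
    cursor at place [k]. *)
Lemma reach_step k s :
  reach cyclic_gens 1 (rotation k * s)%g (rotation (k + o) * s)%g.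
Proof.
apply: reachM; apply: reach_edge; rewrite addrC rotationD.
by apply: cayley_edge_gen; rewrite !inE eqxx.
Qed.

Lemma reach_stepV k s :
  reach cyclic_gens 1 (rotation (k + o) * s)%g (rotation k * s)%g.
Proof.
apply: reachM; apply: reach_edge; rewrite addrC rotationD cayley_edge_sym.
by apply: cayley_edge_gen; rewrite !inE eqxx.
Qed.

(** Conjugation by [rotation k] carries the generator [adjacent_swap] to the transposition of the
    places [k] and [k + o]. *)
Lemma reach_swap k s :
  reach cyclic_gens 1 (rotation k * s)%g (rotation k * (tperm k (k + o) * s))%g.
Proof.
rewrite mulgA; apply: reachM; apply: reach_edge.
have -> : (rotation k * tperm k (k + o) = adjacent_swap * rotation k)%g.
  by rewrite [RHS]conjgC tpermJ !rotationE add0r addrC.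
by apply: cayley_edge_gen; rewrite !inE eqxx orbT.
Qed.

Lemma reach_walk d k l s : l = (k + d)%N :> nat ->
  reach cyclic_gens d (rotation k * s)%g (rotation l * s)%g /\
  reach cyclic_gens d (rotation l * s)%g (rotation k * s)%g.
Proof.
elim: d l => [|d IH] l lE.
  by rewrite addn0 in lE; rewrite (ord_inj lE : l = k); split; apply: reach0.
have ltd : (k + d < m)%N by have := ltn_ord l; lia.
have [l' l'E] : exists l' : I, l' = (k + d)%N :> nat.
  by exists (inord (k + d)); rewrite /= inordK // ltnW.
have lE' : l = l' + o by apply: ord_inj; rewrite val_addo l'E // lE addnS.
have [IH1 IH2] := IH l' l'E; rewrite lE' -(addn1 d); split.
  by apply: reach_trans IH1 _; apply: reach_step.
by rewrite addnC; apply: reach_trans IH2; apply: reach_stepV.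
Qed.

(** * Inversions and gnome sort on a line *)

Definition inversions s := [set p : I * I | (p.1 < p.2)%N && (s p.2 < s p.1)%N].

(** Relabelling places by the transposition embeds the new inversions into the old ones and misses
    the pair of [k] and its successor, which was an inversion. *)
Lemma inversions_swap k s : (k < m)%N -> (s (k + o)%R < s k)%N ->
  (#|inversions (tperm k (k + o)%R * s)%g| < #|inversions s|)%N.
Proof.
move=> km; set l := k + o => lt; set t := tperm k l.
have lE : l = k.+1 :> nat by rewrite val_addo.
have kl : k != l by rewrite eq_ordE lE; lia.
pose f (p : I * I) := (t p.1, t p.2).
have fI : injective f by move=> [a b] [c d] [] /perm_inj-> /perm_inj->.
rewrite -(card_imset _ fI); apply: proper_card; apply/properP; split.
  have tE (i : I) : t i = (if i == k :> nat then k.+1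
      else if i == k.+1 :> nat then k : nat else i) :> nat.
    by rewrite /t permE /= !eq_ordE lE; case: ifP => // _; case: ifP.
  apply/fintype.subsetP=> _ /imsetP[[a b] + ->]; rewrite !inE /= !permM -/t.
  move=> /andP[ab sab].
  rewrite sab andbT; have [/andP[/eqP ak /eqP bl]|] := boolP ((a == k) && (b == l)).
    by move: sab lt; rewrite ak bl /t tpermL tpermR; lia.
  by rewrite !eq_ordE lE !tE; do ![case: ifP => ?]; lia.
exists (k, l); first by rewrite inE; apply/andP; split=> //; apply: eq_leq (esym lE).
apply/negP=> /imsetP[[a b]]; rewrite inE /= !permM => /andP[ab lt'] [ka lb].
have aE : a = l by rewrite -(tpermK k l a) -/t -ka /t tpermL.
have bE : b = k by rewrite -(tpermK k l b) -/t -lb /t tpermR.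
by move: ab; rewrite aE bE lE; lia.
Qed.

(** An increasing [s] satisfies [j <= s j] for every [j], and both sides have the same sum. *)
Lemma increasing_perm s : (forall i j : I, (i < j)%N -> (s i < s j)%N) -> s = 1%g.
Proof.
move=> inc; apply/permP=> i; rewrite perm1.
have ge : forall n (j : I), j = n :> nat -> (n <= s j)%N.
  elim=> // n IH j jE; have nm : (n < m.+1)%N by have := ltn_ord j; lia.
  have := IH (Ordinal nm) erefl; have := inc (Ordinal nm) j.
  by rewrite /= jE => /(_ (ltnSn _)); lia.
have sum : (\sum_(j : I) s j = \sum_(j : I) j)%N.
  by rewrite [RHS](reindex_inj (@perm_inj _ s)).
have /leqif_sum le : forall j : I, predT j -> (j <= s j ?= iff (j == s j))%N.
  by move=> j _; apply/leqif_eq/ge.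
move/esym/eqP: sum; rewrite le.2 => /forallP/(_ i)/implyP/(_ isT).
by rewrite eq_sym => /eqP.
Qed.

Lemma sorted_prefix_fixed_tail s (r : I) :
  (forall i : I, (r < i)%N -> s i = i) ->
  (forall i j : I, (i < j)%N -> (j <= r)%N -> (s i < s j)%N) -> s = 1%g.
Proof.
move=> tail pre; apply: increasing_perm => i j ij.
have [jr|rj] := leqP j r; first exact: pre.
rewrite (tail j rj); have [ir|ri] := leqP i r; last by rewrite tail.
rewrite ltnNge; apply/negP=> jsi; have sr : (r < s i)%N by apply: leq_trans jsi.
by have := perm_inj (tail _ sr) => ssi; move: ir; rewrite -ssi leqNgt sr.
Qed.

(* Gnome sort: walk right while the prefix is sorted, otherwise swap and walk
   left; each round costs at most 2 and decreases 2 * #inversions + (r - k). *)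
Lemma reach_gnome_sort n k (r : I) s : s 0 = 0 -> (k <= r)%N ->
  (forall i : I, (r < i)%N -> s i = i) ->
  (forall i j : I, (i < j)%N -> (j <= k)%N -> (s i < s j)%N) ->
  (2 * #|inversions s| + (r - k) <= n)%N ->
  reach cyclic_gens (2 * n) (rotation k * s)%g (rotation r).
Proof.
elim: n k s => [|n IH] k s s0 kr tail pre pot; have [kr'|rk] := ltnP k r; try lia.
- have rkE : k = r by apply: ord_inj; lia.
  subst k; rewrite (sorted_prefix_fixed_tail tail pre) mulg1.
  exact: reachW (reach0 _ _).
- have km : (k < m)%N by have := ltn_ord r; lia.
  have lE := val_addo km; set l := k + o in lE.
  have [lt|] := ltnP (s k) (s l).
    have -> : (2 * n.+1 = 1 + (1 + 2 * n))%N by lia.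
    apply: reach_trans (reach_step k s) _.
    apply: reachW (leq_addl 1 _) _; apply: IH => //; rewrite -/l ?lE //; last lia.
    move=> i j ij; rewrite leq_eqVlt => /orP[/eqP jE|]; last by apply: pre.
    have -> : j = l by apply: ord_inj; rewrite jE lE.
    have [->//|ik] := eqVneq i k; apply: ltn_trans lt; apply: pre => //.
    by move: ik; rewrite eq_ordE; move: ij; rewrite jE; lia.
  have kl : k != l by rewrite eq_ordE lE; lia.
  rewrite leq_eqVlt -eq_ordE (inj_eq perm_inj) eq_sym (negPf kl) /= => lt.
  have inv := inversions_swap km lt; rewrite -/l in inv.
  (* Place 0 carries the smallest token, so no inversion starts there and the cursor always has room
     to step left after a swap. *)
  have k0 : k != 0 by apply: contraTneq lt => k0; rewrite [in s k]k0 s0.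
  have kgt : (0 < k)%N by rewrite lt0n.
  have k'm : (k.-1 < m.+1)%N by have := ltn_ord k; lia.
  set k' : I := Ordinal k'm.
  have k'E : k = k' + o by apply: ord_inj; rewrite val_addo /=; lia.
  have -> : (2 * n.+1 = 1 + (1 + 2 * n))%N by lia.
  apply: reach_trans (reach_swap k s) _; rewrite -/l.
  rewrite [in rotation k]k'E; apply: reach_trans (reach_stepV k' _) _.
  have tE i : (i < k)%N -> tperm k l i = i.
    by move=> ik; rewrite tpermD // eq_ordE ?lE; lia.
  apply: IH => /=.
  + by rewrite permM tE.
  + lia.
  + move=> i ri; rewrite permM tpermD ?tail // eq_ordE ?lE; lia.
  + by move=> i j ij jk; rewrite !permM !tE; [apply: pre|..]; lia.
  + by move: pot inv; move: #|_| #|_| => x y; lia.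
- have rkE : k = r by apply: ord_inj; lia.
  subst k; rewrite (sorted_prefix_fixed_tail tail pre) mulg1.
  exact: reachW (reach0 _ _).
Qed.

(* In [g], position [i] carries token [g i] and the cursor is at position 0;
   [reading j g] is the arrangement read from token [j], and [cursor j g] the
   place of the cursor in it. *)
Definition reading j g : G := (rotation (g^-1%g j) * g)%g.

Definition cursor j g : I := - g^-1%g j.

Definition masked (P : pred I) g : {ffun I -> option I} :=
  [ffun i => if P i then Some (g i) else None].

(* The keys with indices [inl (inl _)] and [inl (inr _)] are the vertices passed
   on the way to the root in the trees that record the part of the arrangement
   to the right, resp. left, of the cursor; the one with index [inr (x, y)] is
   the cyclic orientation of the tokens [j], [x], [y]. *)
Definition key j (q : I + I + I * I) g : option {ffun I -> option I} :=
  match q with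
  | inl (inl c) =>
      if (cursor j g <= c)%N then Some (masked (fun i => c < i)%N (reading j g)) else None
  | inl (inr c) =>
      if (c <= cursor j g)%N then Some (masked (fun i => i < c)%N (reading j g)) else None
  | inr (x, y) =>
      if ((reading j g)^-1%g x < (reading j g)^-1%g y)%N then Some [ffun=> None] else None
  end.

Arguments cursor : simpl never.
Arguments key : simpl never.

Definition key_dist_at j g h : nat := (\sum_q (key j q g != key j q h))%N.

Definition key_dist g h : nat := (\sum_j key_dist_at j g h)%N.

Lemma readingE j g i : reading j g i = g (i + g^-1%g j).
Proof. by rewrite permM rotationE. Qed.

Lemma reading0 j g : reading j g 0 = j.
Proof. by rewrite readingE add0r permKV. Qed.

Lemma readingV j g x : (reading j g)^-1%g x = g^-1%g x - g^-1%g j.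
Proof. by apply: (@perm_inj _ (reading j g)); rewrite permKV readingE subrK permKV. Qed.

Lemma rotation_cursor j g : (rotation (cursor j g) * reading j g)%g = g.
Proof. by rewrite mulgA -rotationD addNr rotation0 mul1g. Qed.

Lemma masked_inj (P : pred I) g h : masked P g = masked P h ->
  forall i, P i -> g i = h i.
Proof. by move=> /ffunP E i Pi; move: (E i); rewrite !ffunE Pi => -[]. Qed.

Lemma eq_masked (P : pred I) g h : (forall i, P i -> g i = h i) ->
  masked P g = masked P h.
Proof. by move=> E; apply/ffunP => i; rewrite !ffunE; case: ifP => // /E->. Qed.

Lemma count_Ioc n a b : (\sum_(i < n) ((a < i) && (i <= b)) = minn b n.-1 - a)%N.
Proof.
elim: n => [|n IH]; first by rewrite big_ord0; lia.
by rewrite big_ord_recr IH /=; case: ltnP; case: leqP => /=; lia.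
Qed.

Lemma count_Ico n a b : (\sum_(i < n) ((a <= i) && (i < b)) = minn b n - a)%N.
Proof.
elim: n => [|n IH]; first by rewrite big_ord0; lia.
by rewrite big_ord_recr IH /=; case: ltnP; case: leqP => /=; lia.
Qed.

Lemma key_dist_atE j g h : key_dist_at j g h =
  (\sum_c (key j (inl (inl c)) g != key j (inl (inl c)) h) +
   \sum_c (key j (inl (inr c)) g != key j (inl (inr c)) h) +
   \sum_x \sum_y (key j (inr (x, y)) g != key j (inr (x, y)) h))%N.
Proof.
rewrite /key_dist_at big_sumType big_sumType pair_big.
by congr (_ + _)%N; apply: eq_bigr => -[].
Qed.

(** The readings agree before [L] and after [R]. The route walks left from [k] to [L], sorts while
    moving to [R], and walks back to [l], which costs at most [(k - L) + 2 * (2 * #|inversions s| +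
    (R - L)) + (R - l)]. The three kinds of keys bound these terms. *)
Lemma reach_key_dist_at j g h :
  reach cyclic_gens (4 * key_dist_at j g h) g h.
Proof.
set a := reading j g; set b := reading j h.
set k := cursor j g; set l := cursor j h.
pose s := (a * b^-1)%g.
have sE i : (s i == i) = (a i == b i).
  by rewrite permM (can2_eq (permKV b) (permK b)).
have s0 : s 0 = 0 by apply/eqP; rewrite sE /a /b !reading0.
pose PL n := [&& n <= k, n <= l & [forall i : I, (i < n) ==> (s i == i)]]%N.
have PL0 : exists n, PL n by exists 0%N; apply/forallP.
have PLb n : PL n -> (n <= k)%N by case/and3P.
case: (ex_maxnP PL0 PLb) => L /and3P[Lk Ll /forallP sL] Lmax.
have {}sL i : (i < L)%N -> s i = i by move=> iL; apply/eqP/(implyP (sL i)).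
pose PR n := [&& k <= n, l <= n & [forall i : I, (n < i) ==> (s i == i)]]%N.
have PR0 : exists n, PR n.
  exists m; rewrite /PR -ltnS ltn_ord -ltnS ltn_ord; apply/forallP => i.
  by apply/implyP; rewrite ltnNge -ltnS ltn_ord.
case: (ex_minnP PR0) => R /and3P[kR lR /forallP sR] Rmin.
have {}sR i : (R < i)%N -> s i = i by move=> iR; apply/eqP/(implyP (sR i)).
have Rm : (R <= m)%N.
  apply: Rmin; rewrite /PR -ltnS ltn_ord -ltnS ltn_ord; apply/forallP => i.
  by apply/implyP; rewrite ltnNge -ltnS ltn_ord.
(* If the left keys at some [c] with [L < c <= maxn k l] agreed, both cursors would be at or beyond
   [c] and the readings equal before [c], against the maximality of [L]. The bound [d1] is the
   mirror image. *)
have d2 : (maxn k l - L <= \sum_c (key j (inl (inr c)) g != key j (inl (inr c)) h))%N.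
  have -> : (maxn k l - L = \sum_(c : I) ((L < c) && (c <= maxn k l)))%N.
    rewrite count_Ioc; move: (ltn_ord k) (ltn_ord l).
    by move: (k : nat) (l : nat); clear; lia.
  apply: leq_sum => c _; case: andP => //= -[Lc cm]; rewrite lt0b /key -/k -/l.
  have [ck|kc] := leqP c k; have [cl|lc] := leqP c l; [|by []|by []|]; last first.
    by move: cm; rewrite leq_max (leqNgt c k) (leqNgt c l) kc lc.
  apply/eqP=> -[] /masked_inj E; suff /Lmax : PL c by lia.
  by rewrite /PL ck cl; apply/forallP=> i; apply/implyP=> ic; rewrite sE; apply/eqP/E.
have d1 : (R - minn k l <= \sum_c (key j (inl (inl c)) g != key j (inl (inl c)) h))%N.
  have -> : (R - minn k l = \sum_(c : I) ((minn k l <= c) && (c < R)))%N.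
    by rewrite count_Ico; move: Rm; clear; lia.
  apply: leq_sum => c _; case: andP => //= -[cm cR]; rewrite lt0b /key -/k -/l.
  have [kc|ck] := leqP k c; have [lc|cl] := leqP l c; [|by []|by []|]; last first.
    by move: cm; rewrite geq_min (leqNgt k c) (leqNgt l c) ck cl.
  apply/eqP=> -[] /masked_inj E; suff /Rmin : PR c by lia.
  by rewrite /PR kc lc; apply/forallP=> i; apply/implyP=> ic; rewrite sE; apply/eqP/E.
(* The map [a] turns a pair of places inverted by [s] into a pair of tokens that the two readings
   order oppositely. *)
have d3 : (#|inversions s| <=
    \sum_x \sum_y (key j (inr (x, y)) g != key j (inr (x, y)) h))%N.
  rewrite pair_big (reindex (fun p : I * I => (a p.1, a p.2))) /=; last first.
    exists (fun p => (a^-1%g p.1, a^-1%g p.2)) => -[x y] _ /=;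
      by rewrite ?permK ?permKV.
  rewrite -sum1_card big_mkcond; apply: leq_sum => -[x y] _ /=.
  rewrite inE /=; case: andP => //= -[xy yx]; rewrite /key -/a -/b !permK xy.
  by move: yx; rewrite !permM ltnNge leq_eqVlt negb_or => /andP[_ /negPf->].
have LR : (L <= R)%N by lia.
have Lm : (L < m.+1)%N by lia.
have Rm' : (R < m.+1)%N by lia.
pose L' := Ordinal Lm; pose R' := Ordinal Rm'.
have kE : k = (L' + (k - L))%N :> nat by rewrite /= subnKC.
have RE : R' = (l + (R - l))%N :> nat by rewrite /= subnKC.
have [_ walk1] := reach_walk s kE.
have [_ walk2] := reach_walk 1%g RE.
have sort := @reach_gnome_sort _ L' R' s s0 LR sR _ (leqnn _).
have /sort {}sort : forall i i' : I, (i < i')%N -> (i' <= L')%N -> (s i < s i')%N.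
  move=> i i' ii' i'L; rewrite sL; last by apply: leq_trans i'L.
  have [i'L'|Li'] := ltnP i' L; first by rewrite sL.
  rewrite ltnNge; apply/negP => si; have si' : (s i' < L)%N.
    by apply: leq_ltn_trans si _; apply: leq_trans i'L.
  by have := perm_inj (sL _ si') => E; move: si'; rewrite E ltnNge Li'.
rewrite mulg1 in walk2; rewrite mulg1 in walk2.
have := reach_trans (reach_trans walk1 sort) walk2.
move=> /(reachM b); rewrite -mulgA /s mulgKV -/k.
rewrite [X in reach _ _ X]rotation_cursor rotation_cursor; apply: reachW.
rewrite key_dist_atE [(L' : nat)]/= [(R' : nat)]/=.
move: d1 d2 d3 Lk Ll kR lR; move: (k : nat) (l : nat) (\sum_c _)%N (\sum_c _)%N.
move: (\sum_x _)%N #|_|; clear; lia.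
Qed.

(** The cheapest token to cut at costs at most the average over all tokens. *)
Lemma reach_key_dist g h : exists n,
  reach cyclic_gens n g h /\ (m.+1 * n <= 4 * key_dist g h)%N.
Proof.
pose j := [arg min_(j < 0) key_dist_at j g h].
exists (4 * key_dist_at j g h)%N; split; first exact: reach_key_dist_at.
rewrite mulnCA leq_mul2l /= /key_dist -{1}(card_ord m.+1) -sum_nat_const.
by apply: leq_sum => i _; rewrite /j; case: arg_minnP => // j' _; apply.
Qed.

(** * Effect of the two generators on the keys *)

Lemma sum_pred1 (T : finType) (x : T) : (\sum_(c : T) (c == x) = 1)%N.
Proof. by rewrite (bigD1 x) //= eqxx big1 // => c /negPf->. Qed.

(** Serves to bound the indicator of a changed key by the sum of the indicators of the exceptional
    cases. *)
Lemma leq_bool (a b : bool) n : (~~ b -> n = 0 :> nat -> a = false) -> (a <= b + n)%N.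
Proof. by case: b => /=; case: n => // [|n]; case: a => // /(_ isT erefl). Qed.

(** The readings stay and the cursor moves one place, so for each [j] one right key and one left key
    change. Only when the cursor wraps around, which happens for a single [j], may all [m.+1] keys
    of either kind change. *)
Lemma key_dist_rotation g : (key_dist g (rotation cyc_one * g) <= 4 * m.+1)%N.
Proof.
set g' := (_ * g)%g.
have g'V j : g'^-1%g j = g^-1%g j - o by rewrite invMg permM rotationV rotationE.
have cursorE j : cursor j g' = cursor j g + o by rewrite /cursor g'V opprB addrC.
have readE j : reading j g' = reading j g.
  by apply/permP => i; rewrite !readingE g'V permM rotationE addrA subrK.
have wrap : (\sum_j \sum_(c : I) (cursor j g == ord_max) = m.+1)%N.
  under eq_bigr => j _ do rewrite sum_nat_const card_ord.
  rewrite -big_distrr /= (reindex_inj (inj_comp (@perm_inj _ g) oppr_inj)) /=.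
  under eq_bigr => j _ do rewrite /cursor permK opprK.
  by rewrite sum_pred1 muln1.
have kE j :
    cursor j g + o = (if cursor j g == ord_max then 0%N else (cursor j g).+1) :> nat.
  case: eqP => [->|/eqP km].
    by apply/eqP; rewrite /= modnDmr addn1 modnn.
  rewrite val_addo //; move: km; rewrite eq_ordE /=; have := ltn_ord (cursor j g); lia.
rewrite /key_dist; under eq_bigr => j _ do rewrite key_dist_atE.
rewrite !big_split /= [X in (_ + X)%N]big1 ?addn0; last first.
  by move=> j _; rewrite big1 // => x _; rewrite big1 // => y _; rewrite /key readE eqxx.
have -> : (4 * m.+1 = (m.+1 + m.+1) + (m.+1 + m.+1))%N by lia.
have unit (k : I -> I) : (\sum_j \sum_c (c == k j) = m.+1)%N.
  by under eq_bigr => j _ do rewrite sum_pred1; rewrite sum_nat_const card_ord muln1.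
apply: leq_add.
  apply: (@leq_trans (\sum_j \sum_c (c == cursor j g) +
    \sum_j \sum_(c : I) (cursor j g == ord_max))%N); last by rewrite unit wrap.
  rewrite -big_split; apply: leq_sum => j _; rewrite -big_split; apply: leq_sum => c _ /=.
  apply: leq_bool => ck /eqP; rewrite eqb0 => km.
  rewrite /key readE cursorE kE (negPf km).
  suff -> : (cursor j g < c)%N = (cursor j g <= c)%N by rewrite eqxx.
  by rewrite [RHS]leq_eqVlt -eq_ordE eq_sym (negPf ck).
apply: (@leq_trans (\sum_j \sum_c (c == (cursor j g + o)%R) +
  \sum_j \sum_(c : I) (cursor j g == ord_max))%N).
2: by rewrite (unit (fun j => cursor j g + o)) wrap.
rewrite -big_split; apply: leq_sum => j _; rewrite -big_split; apply: leq_sum => c _ /=.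
apply: leq_bool => ck /eqP; rewrite eqb0 => km.
rewrite /key readE cursorE; move: ck; rewrite eq_ordE kE (negPf km) => ck.
suff -> : (c <= (cursor j g).+1)%N = (c <= cursor j g)%N by rewrite eqxx.
by rewrite [LHS]leq_eqVlt (negPf ck).
Qed.

(** Reduces the order after cutting at [j] to comparisons within the uncut order, where the effect
    of a swap is visible. *)
Lemma place_ltE (x y j : I) : ((x - j)%R < (y - j)%R)%N =
  if (j <= x)%N then (if (j <= y)%N then (x < y)%N else true)
  else (if (j <= y)%N then false else (x < y)%N).
Proof.
have subE (a b : I) : (a - b : I) = (if b <= a then a - b else m.+1 + a - b)%N :> nat.
  have := ltn_ord a; have := ltn_ord b => bm am.
  rewrite /= modnDmr; case: leqP => ab.
    by rewrite addnBA ?(ltnW bm) // addnC -addnBA // modnDl modn_small; lia.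
  by rewrite modn_small; lia.
rewrite !subE; have := ltn_ord x; have := ltn_ord y; have := ltn_ord j.
by have [jx|xj] := leqP j x; have [jy|yj] := leqP j y; move=> *; apply/idP/idP; lia.
Qed.

Lemma leq_adjacent_swap (a b : I) :
  ~~ ((a == 0) && (b == o)) -> ~~ ((a == o) && (b == 0)) ->
  (adjacent_swap a <= adjacent_swap b)%N = (a <= b)%N.
Proof.
have [m0|m_gt0] := posnP m.
  have I0 (i : I) : i = 0 by apply: ord_inj; have := ltn_ord i; move=> /=; lia.
  by rewrite (I0 a) (I0 b) !leqnn.
have oE : o = 1%N :> nat by rewrite /= modn_small.
have tE (i : I) : adjacent_swap i = (if i == 0%N :> nat then 1%N
    else if i == 1%N :> nat then 0%N else i) :> nat.
  by rewrite permE /= !eq_ordE oE; case: ifP => //; case: ifP.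
rewrite !eq_ordE oE !tE /=.
by do ![case: ifP => ?] => ? ?; apply/idP/idP; lia.
Qed.

(** Let [u], [v] be the swapped tokens. Right keys change only for [c] at the cursor or for [j]
    equal to [u] or [v], left keys only for these [j], and orientations only if two of [j], [x], [y]
    are [u] and [v] in some order. This gives 3 + 2 + 6 families of [m.+1] keys. *)
Lemma key_dist_swap g : (key_dist g (adjacent_swap * g) <= 11 * m.+1)%N.
Proof.
set g' := (_ * g)%g; set u := g 0; set v := g o.
have g'V j : g'^-1%g j = adjacent_swap (g^-1%g j) by rewrite invMg permM tpermV.
have posu j : (g^-1%g j == 0) = (j == u) by rewrite (can2_eq (permKV g) (permK g)).
have posv j : (g^-1%g j == o) = (j == v) by rewrite (can2_eq (permKV g) (permK g)).
have fix_j j : j != u -> j != v -> g'^-1%g j = g^-1%g j.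
  by rewrite -posu -posv g'V => ? ?; rewrite tpermD // eq_sym.
have cursorE j : j != u -> j != v -> cursor j g' = cursor j g.
  by move=> ju jv; rewrite /cursor fix_j.
have readE j i : j != u -> j != v -> i != cursor j g -> i != cursor j g + o ->
    reading j g' i = reading j g i.
  move=> ju jv ik il; rewrite !readingE fix_j // permM tpermD // eq_sym.
  - by rewrite addr_eq0.
  - by rewrite -(inj_eq (addIr (- g^-1%g j))) addrK addrC.
(* With the cursor at the last place, the cyclically next token [v] would be the first one, [j].
   Hence the swapped places do not straddle the cut. *)
have not_max j : j != v -> (cursor j g < m)%N.
  move=> jv; rewrite ltn_neqAle -ltnS ltn_ord andbT.
  apply: contraNN jv => /eqP km; rewrite -posv -(inj_eq oppr_inj) -/(cursor j g).
  rewrite -subr_eq0 opprK; apply/eqP/ord_inj; rewrite /= modnDmr.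
  by rewrite -[X in (X + _)%N]/(nat_of_ord (cursor j g)) km addn1 modnn.
rewrite /key_dist; under eq_bigr => j _ do rewrite key_dist_atE.
rewrite !big_split /=.
have colw w : (\sum_(j : I) \sum_(c : I) (j == w) = m.+1)%N.
  under eq_bigr => j _ do rewrite sum_nat_const card_ord.
  by rewrite -big_distrr /= sum_pred1 muln1.
have unit (k : I -> I) : (\sum_j \sum_c (c == k j) = m.+1)%N.
  by under eq_bigr => j _ do rewrite sum_pred1; rewrite sum_nat_const card_ord muln1.
have pairs w w' : (\sum_(x : I) \sum_(y : I) ((x == w) && (y == w')) = 1)%N.
  under eq_bigr => x _ do under eq_bigr => y _ do rewrite -mulnb.
  under eq_bigr => x _ do rewrite -big_distrr /= sum_pred1 muln1.
  exact: sum_pred1.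
have jx w w' : (\sum_(j : I) \sum_(x : I) \sum_(y : I) ((j == w) && (x == w')) = m.+1)%N.
  transitivity (m.+1 * \sum_(j : I) \sum_(x : I) ((j == w) && (x == w')))%N.
    rewrite big_distrr /=; apply: eq_bigr => j _; rewrite big_distrr /=.
    by apply: eq_bigr => x _; rewrite sum_nat_const card_ord.
  by rewrite pairs muln1.
have jy w w' : (\sum_(j : I) \sum_(x : I) \sum_(y : I) ((j == w) && (y == w')) = m.+1)%N.
  by rewrite -[RHS](jx w w'); apply: eq_bigr => j _; rewrite exchange_big.
have xy w w' : (\sum_(j : I) \sum_(x : I) \sum_(y : I) ((x == w) && (y == w')) = m.+1)%N.
  by under eq_bigr => j _ do rewrite pairs; rewrite sum_nat_const card_ord muln1.
have -> : (11 * m.+1 = (m.+1 + (m.+1 + m.+1)) + (m.+1 + m.+1) +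
  (m.+1 + (m.+1 + (m.+1 + (m.+1 + (m.+1 + m.+1))))))%N by lia.
apply: leq_add; first apply: leq_add.
- apply: (@leq_trans (\sum_j \sum_c (c == cursor j g) +
    (\sum_j \sum_(c : I) (j == u) + \sum_j \sum_(c : I) (j == v)))%N).
  2: by rewrite unit !colw.
  rewrite -!big_split; apply: leq_sum => j _.
  rewrite -!big_split; apply: leq_sum => c _ /=.
  apply: leq_bool => ck /eqP; rewrite addn_eq0 !eqb0 => /andP[ju jv].
  rewrite /key cursorE //; case: leqP => // kc; apply/negbTE; rewrite negbK; apply/eqP.
  congr Some; apply: eq_masked => i ci; rewrite readE // eq_ordE ?val_addo ?not_max //.
    by move: kc ci; clear; lia.
  by move: ck kc ci; rewrite eq_ordE; clear; lia.
- apply: (@leq_trans (\sum_j \sum_(c : I) (j == u) + \sum_j \sum_(c : I) (j == v))%N).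
  2: by rewrite !colw.
  rewrite -!big_split; apply: leq_sum => j _.
  rewrite -!big_split; apply: leq_sum => c _ /=.
  apply: leq_bool => ju /eqP; rewrite !eqb0 => jv.
  rewrite /key cursorE //; case: leqP => // kc; apply/negbTE; rewrite negbK; apply/eqP.
  congr Some; apply: eq_masked => i ci; rewrite readE // eq_ordE ?val_addo ?not_max //.
    by move: kc ci; clear; lia.
  by move: kc ci; clear; lia.
- pose T (f1 f2 : I -> I -> I -> I) w w' :=
    (\sum_j \sum_x \sum_y ((f1 j x y == w) && (f2 j x y == w')))%N.
  pose pj (j x y : I) := j; pose px (j x y : I) := x; pose py (j x y : I) := y.
  apply: (@leq_trans (T pj px u v + (T pj px v u + (T pj py u v + (T pj py v u +
    (T px py u v + T px py v u)))))%N).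
  2: by rewrite /T !jx !jy !xy.
  rewrite -!big_split; apply: leq_sum => j _; rewrite -!big_split.
  apply: leq_sum => x _; rewrite -!big_split; apply: leq_sum => y _ /=.
  apply: leq_bool => jx1 /eqP; rewrite !addn_eq0 !eqb0 -!posu -!posv.
  rewrite -posu -posv in jx1; case/and5P => jx2 jy1 jy2 xy1 xy2.
  rewrite /key !readingV !g'V !place_ltE.
  move: jx1 jx2 jy1 jy2 xy1 xy2; move: (g^-1%g x) (g^-1%g y) (g^-1%g j) => a b c *.
  rewrite (ltnNge a b) (ltnNge (adjacent_swap a)) !leq_adjacent_swap ?eqxx //.
  all: by rewrite andbC.
Qed.

End CyclicArrangements.

(** * A Poincare inequality relative to an abelian subgroup *)

Section WalshTransform.
Variables (R : realFieldType) (A : finZmodType) (chi : A -> A -> R).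
Hypothesis chiD : forall w u v, chi w (u + v) = chi w u * chi w v.
Hypothesis chi2 : forall w u, chi w u ^+ 2 = 1.
Hypothesis chi_sum : forall u, \sum_w chi w u = #|A|%:R * (u == 0)%:R.
Hypothesis chi0l : forall u, chi 0 u = 1.

Variables (gT : finGroupType) (tau : A -> gT).
Hypothesis tauD : forall u v, tau (u + v) = (tau u * tau v)%g.
Implicit Types (f : gT -> R) (w u v : A) (g : gT).

Local Notation N := (#|A|%:R : R).

Definition walsh f w g := \sum_v chi w v * f (tau v * g)%g.

Definition energy f w := \sum_g walsh f w g ^+ 2.

Lemma energy_ge0 f w : 0 <= energy f w.
Proof. by apply: sumr_ge0 => g _; apply: sqr_ge0. Qed.

Lemma chi_mulV w u v : chi w u * chi w v = chi w (u - v).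
Proof.
by rewrite -[X in chi w X * _](subrK v) [chi w (_ + v)]chiD -mulrA -expr2 chi2 mulr1.
Qed.

Lemma sum_translate f u : \sum_g f (tau u * g)%g = \sum_g f g.
Proof. by rewrite [RHS](reindex_inj (mulgI (tau u))). Qed.

(** One factor [N] is the orthogonality of the characters; the other arises because [energy] sums
    over all [g], so each value of [f] is met [N] times. *)
Lemma parseval f : \sum_w energy f w = N ^+ 2 * \sum_g f g ^+ 2.
Proof.
transitivity (\sum_g N * \sum_u f (tau u * g)%g ^+ 2); last first.
  rewrite -big_distrr exchange_big /= (eq_bigr (fun=> \sum_g f g ^+ 2)).
    by rewrite sumr_const -[X in _ * X = _]mulr_natl mulrA expr2.
  by move=> u _; rewrite (sum_translate (fun g => f g ^+ 2)).
rewrite exchange_big; apply: eq_bigr => g _ /=; rewrite big_distrr /=.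
transitivity (\sum_u \sum_v f (tau u * g)%g * f (tau v * g)%g * \sum_w chi w (u - v)).
  under [RHS]eq_bigr => u _ do under eq_bigr => v _ do rewrite big_distrr /=.
  under [RHS]eq_bigr => u _ do rewrite exchange_big /=.
  rewrite [RHS]exchange_big; apply: eq_bigr => w _ /=; rewrite expr2 big_distrl.
  apply: eq_bigr => u _ /=; rewrite big_distrr; apply: eq_bigr => v _ /=.
  by rewrite -chi_mulV; ring.
apply: eq_bigr => u _; rewrite (bigD1 u) //= subrr chi_sum eqxx big1.
  by rewrite addr0 mulr1 mulrC expr2.
by move=> v vu; rewrite chi_sum subr_eq0 eq_sym (negPf vu) !mulr0.
Qed.

Lemma walsh_translate f u w g :
  walsh (fun g => f (tau u * g)%g) w g = chi w u * walsh f w g.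
Proof.
rewrite /walsh big_distrr (reindex_inj (addrI (- u))) /=; apply: eq_bigr => v _.
by rewrite mulgA -tauD addrA subrr add0r addrC -chi_mulV; ring.
Qed.

Lemma walshB f1 f2 w g :
  walsh (fun g => f1 g - f2 g) w g = walsh f1 w g - walsh f2 w g.
Proof. by rewrite -sumrB; apply: eq_bigr => v _; rewrite mulrBr. Qed.

Lemma translate_energy f u :
  N ^+ 2 * \sum_g (f (tau u * g)%g - f g) ^+ 2 =
  \sum_w (chi w u - 1) ^+ 2 * energy f w.
Proof.
rewrite -(parseval (fun g => f (tau u * g)%g - f g)); apply: eq_bigr => w _.
rewrite big_distrr; apply: eq_bigr => g _ /=.
by rewrite walshB walsh_translate; ring.
Qed.

Section Automorphism.
Variables (s : gT) (phi psi : A -> A).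
Hypothesis s_tau : forall v, (s * tau v = tau (phi v) * s)%g.
Hypothesis phiK : involutive phi.
Hypothesis psiK : involutive psi.
Hypothesis chi_adj : forall w v, chi w (phi v) = chi (psi w) v.

(** Multiplication by [s] normalises the translations through [phi], so it permutes the characters
    through the adjoint [psi]. *)
Lemma walsh_automorphism f w g :
  walsh (fun g => f (s * g)%g) w g = walsh f (psi w) (s * g)%g.
Proof.
rewrite /walsh (reindex_inj (inv_inj phiK)) /=; apply: eq_bigr => v _.
by rewrite mulgA s_tau phiK chi_adj mulgA.
Qed.

(* Schur test: 2xy <= c x^2 + y^2 / c with c = h (psi w) / h w. *)
Lemma automorphism_energy (h : A -> R) f : (forall w, 0 < h w) ->
  2 * \sum_w energy f w * (1 - h (psi w) / h w) <=
  N ^+ 2 * \sum_g (f (s * g)%g - f g) ^+ 2.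
Proof.
move=> h_gt0; rewrite -(parseval (fun g => f (s * g)%g - f g)).
(* Symmetrising over the orbits of the involution [psi] pairs each [w] with [psi w], and the Schur
   test then reduces to a perfect square. *)
have swap : \sum_w energy f w * (1 - h (psi w) / h w) =
    \sum_w energy f (psi w) * (1 - h w / h (psi w)).
  by rewrite (reindex_inj (inv_inj psiK)); apply: eq_bigr => w _; rewrite psiK.
rewrite mulr_natl mulr2n [X in X + _]swap -big_split; apply: ler_sum => w _ /=.
have -> : energy f (psi w) = \sum_g walsh f (psi w) (s * g)%g ^+ 2.
  by rewrite /energy (reindex_inj (mulgI s)).
rewrite /energy !big_distrl -big_split; apply: ler_sum => g _ /=.
rewrite walshB walsh_automorphism; move: (walsh _ _ _) (walsh _ _ _) => x y.
have := h_gt0 w; have := h_gt0 (psi w); move: (h w) (h _) => a b b0 a0.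
rewrite -subr_ge0.
have -> : (y - x) ^+ 2 - (y ^+ 2 * (1 - a / b) + x ^+ 2 * (1 - b / a)) =
    a / b * (y - b / a * x) ^+ 2 by field; rewrite !gt_eqF.
by rewrite mulr_ge0 ?sqr_ge0 // divr_ge0 // ltW.
Qed.

End Automorphism.

(** The translations on the left only see the energy of nonzero characters. Superharmonicity of [h],
    summed over the automorphisms, bounds it up to the energy on [B], and the translations by [u j]
    bound the latter. *)
Lemma walsh_poincare (I J : finType) (s : I -> gT) (phi psi : I -> A -> A)
    (u : J -> A) (h : A -> R) (B : pred A) (delta C : R) f :
  (forall i v, (s i * tau v = tau (phi i v) * s i)%g) ->
  (forall i, involutive (phi i)) -> (forall i, involutive (psi i)) ->
  (forall i w v, chi w (phi i v) = chi (psi i w) v) ->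
  (forall w, 0 < h w) -> (forall i, psi i 0 = 0) -> 0 <= C -> 0 <= delta ->
  (forall w, w != 0 ->
     delta - C * (B w)%:R <= \sum_i (1 - h (psi i w) / h w)) ->
  (forall w, B w -> exists j, chi w (u j) = -1) ->
  delta * \sum_v \sum_g (f (tau v * g)%g - f g) ^+ 2 <=
  N * (2 * \sum_i \sum_g (f (s i * g)%g - f g) ^+ 2 +
       C * \sum_j \sum_g (f (tau (u j) * g)%g - f g) ^+ 2).
Proof.
move=> s_tau phiK psiK adj h_gt0 psi0 C0 delta0 superharmonic boundary.
have Ngt0 : 0 < N by rewrite ltr0n; apply/card_gt0P; exists 0.
pose F := \sum_(w | w != 0) energy f w.
pose FB := \sum_w energy f w * (B w)%:R.
set ES := \sum_i \sum_g (f (s i * g)%g - f g) ^+ 2.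
set EU := \sum_j \sum_g (f (tau (u j) * g)%g - f g) ^+ 2.
(* The 4 is [(chi w (u j) - 1) ^+ 2] at a character with value -1. *)
have boundary_le : 4 * FB <= N ^+ 2 * EU.
  rewrite /EU [leRHS]mulr_sumr; under [leRHS]eq_bigr => j _ do rewrite translate_energy.
  rewrite [leRHS]exchange_big /FB [leLHS]mulr_sumr.
  apply: ler_sum => w _ /=; rewrite -mulr_suml.
  rewrite mulrCA mulrC ler_wpM2r ?energy_ge0 //.
  have [/boundary[j wj]|_] := boolP (B w); last first.
    by rewrite mulr0; apply: sumr_ge0 => j _; apply: sqr_ge0.
  rewrite (bigD1 j) //= wj.
  have : 0 <= \sum_(i | i != j) (chi w (u i) - 1) ^+ 2.
    by apply: sumr_ge0 => i _; apply: sqr_ge0.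
  by move: (\sum_(_ | _) _) => t t0; lra.
have interior_le : 2 * (delta * F - C * FB) <= N ^+ 2 * ES.
  have: \sum_i 2 * \sum_w energy f w * (1 - h (psi i w) / h w) <= N ^+ 2 * ES.
    rewrite /ES [leRHS]mulr_sumr; apply: ler_sum => i _.
    exact: (automorphism_energy (s_tau i) (phiK i) (psiK i) (adj i)).
  apply: le_trans; rewrite -mulr_sumr ler_pM2l // exchange_big /=.
  under [leRHS]eq_bigr => w _ do rewrite -mulr_sumr.
  rewrite /F big_mkcond /= mulr_sumr mulr_sumr -sumrB; apply: ler_sum => w _.
  (* Every [psi i] fixes 0, so the trivial character contributes 0 to the sum of defects. *)
  have [->|w0] := eqVneq w 0.
    rewrite big1 ?mulr0 ?sub0r; last by move=> i _; rewrite psi0 divff ?gt_eqF ?subrr.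
    by rewrite oppr_le0 !mulr_ge0 ?energy_ge0.
  have := ler_wpM2l (energy_ge0 f w) (superharmonic w w0).
  by apply: le_trans; rewrite /= le_eqVlt; apply/orP; left; apply/eqP; ring.
have total_le : N ^+ 2 * \sum_v \sum_g (f (tau v * g)%g - f g) ^+ 2 <= 4 * N * F.
  rewrite [leLHS]mulr_sumr; under [leLHS]eq_bigr => v _ do rewrite translate_energy.
  rewrite [leLHS]exchange_big /F [X in _ <= _ * X]big_mkcond [leRHS]mulr_sumr.
  apply: ler_sum => w _ /=.
  have [->|w0] := eqVneq w 0.
    by rewrite big1 ?mulr0 // => v _; rewrite chi0l subrr expr0n mul0r.
  rewrite -mulr_suml ler_wpM2r ?energy_ge0 // [4 * N]mulrC mulr_natl -sumr_const.
  apply: ler_sum => v _; have := chi2 w v; have := sqr_ge0 (chi w v + 1).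
  by move: (chi w v) => c; nra.
rewrite -(ler_pM2l Ngt0).
have NF : N * \sum_v \sum_g (f (tau v * g)%g - f g) ^+ 2 <= 4 * F.
  by rewrite -(ler_pM2l Ngt0) mulrA -expr2 (le_trans total_le) // mulrCA mulrA.
apply: (@le_trans _ _ (4 * (delta * F))).
  by rewrite mulrCA [leRHS]mulrCA ler_wpM2l.
rewrite [N * (N * _)]mulrA -expr2 mulrDr [_ ^+ 2 * (C * _)]mulrCA [_ ^+ 2 * (2 * _)]mulrCA.
by have := ler_wpM2l C0 boundary_le; lra.
Qed.
End WalshTransform.

(** * Rows over the field with two elements and their lengths *)

Lemma F2_neq0 (z : 'F_2) : z != 0 -> z = 1.
Proof. by case: z => -[|[|//]] lt z0; apply: val_inj. Qed.

Lemma F2_addrr (z : 'F_2) : z + z = 0.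
Proof. by case: z => -[|[|//]] lt; apply: val_inj. Qed.

Lemma F2_mx_addrr p q (w : 'M['F_2]_(p, q)) : w + w = 0.
Proof. by apply/matrixP=> i j; rewrite !mxE F2_addrr. Qed.

Section RowLength.
Variable k : nat.
Implicit Types x y : 'rV['F_2]_k.

(* A row is read as a polynomial over F_2 of degree < k, [row_len] being its
   size and right multiplication by [shift_mx] multiplication by X. *)
Definition row_len x := (\max_(i < k | x 0%R i != 0%R) i.+1)%N.

Definition shift_mx : 'M['F_2]_k := \matrix_(i, j) (j == i.+1 :> nat)%:R.

Lemma row_lenP x n :
  reflect (forall i : 'I_k, (n <= i)%N -> x 0 i = 0) (row_len x <= n)%N.
Proof.
apply: (iffP (bigmax_leqP _ _ _)) => H i.
  move=> ni; apply/eqP; apply: contraTT ni => xi.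
  by rewrite -ltnNge; apply: H.
by move=> xi; rewrite ltnNge; apply: contra xi => ni; rewrite H.
Qed.

Lemma row_len_max x : (row_len x <= k)%N.
Proof. by apply/row_lenP => i; rewrite leqNgt ltn_ord. Qed.

Lemma row_len_lead x n : row_len x = n.+1 -> exists2 i : 'I_k, i = n :> nat & x 0 i = 1.
Proof.
move=> xn; have : ~~ (row_len x <= n)%N by rewrite xn ltnn.
case: (boolP [exists i : 'I_k, (n <= i)%N && (x 0 i != 0)]).
  case/existsP=> i /andP[ni xi] _; exists i; last exact: F2_neq0.
  have : (i.+1 <= row_len x)%N by apply: (@leq_bigmax_cond _ _ (fun i : 'I_k => i.+1)).
  by rewrite xn ltnS => ?; apply/eqP; rewrite eqn_leq ni andbT.
rewrite negb_exists => /forallP H /row_lenP[] i ni; apply/eqP.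
by have := H i; rewrite ni negbK.
Qed.

Lemma row_len0 x : (row_len x == 0)%N = (x == 0).
Proof.
rewrite -leqn0; apply/row_lenP/eqP => [H|-> i _]; last by rewrite mxE.
by apply/rowP=> i; rewrite H // mxE.
Qed.

Lemma row_lenD x y : (row_len (x + y) <= maxn (row_len x) (row_len y))%N.
Proof.
apply/row_lenP=> i; rewrite geq_max => /andP[xi yi].
by rewrite mxE (row_lenP _ _ (leqnn _) _ xi) (row_lenP _ _ (leqnn _) _ yi) addr0.
Qed.

Lemma row_lenD_lt x y : (row_len y < row_len x)%N -> row_len (x + y) = row_len x.
Proof.
move=> yx; have := row_lenD x y; have := row_lenD (x + y) y.
by rewrite -addrA F2_mx_addrr addr0; lia.
Qed.

(** Both leading coefficients are 1 and cancel in characteristic 2. *)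
Lemma row_lenD_eq x y : row_len x = row_len y -> (0 < row_len x)%N ->
  (row_len (x + y) < row_len x)%N.
Proof.
case xn: (row_len x) => [//|n] /esym yn _; apply/row_lenP => i ni; rewrite mxE.
have [a an xa] := row_len_lead xn; have [b bn yb] := row_len_lead yn.
have [ni'|in_] := ltnP n i.
  by rewrite (row_lenP _ _ (leqnn _) i) ?xn // (row_lenP _ _ (leqnn _) i) ?yn ?addr0.
have -> : x 0 i = 1 by rewrite (_ : i = a) //; apply: ord_inj; lia.
have -> : y 0 i = 1 by rewrite (_ : i = b) //; apply: ord_inj; lia.
exact: F2_addrr.
Qed.

Lemma shift_mxE x (i j : 'I_k) : j = i.+1 :> nat -> (x *m shift_mx) 0 j = x 0 i.
Proof.
move=> ji; rewrite mxE (bigD1 i) //= mxE ji eqxx mulr1 big1 ?addr0 // => l li.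
rewrite mxE ji eqSS; case: eqP => [il|_]; last by rewrite mulr0.
by move: li; rewrite (ord_inj il) eqxx.
Qed.

Lemma row_len_shift_le x : (row_len (x *m shift_mx) <= (row_len x).+1)%N.
Proof.
apply/row_lenP=> j nj; rewrite mxE big1 // => i _; rewrite mxE.
case: eqP => [ji|_]; last by rewrite mulr0.
by rewrite (row_lenP _ _ (leqnn _) i) ?mul0r //; move: nj; rewrite ji.
Qed.

(** The shift truncates; a length below [k] ensures that the leading coefficient survives. *)
Lemma row_len_shift x : (0 < row_len x)%N -> (row_len x < k)%N ->
  row_len (x *m shift_mx) = (row_len x).+1.
Proof.
case xn: (row_len x) => [//|n] _ nk; apply/eqP.
rewrite eqn_leq -{1}xn row_len_shift_le ltnNge /=; apply/negP => /row_lenP.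
have [i iE xi] := row_len_lead xn.
by move/(_ (Ordinal nk) (leqnn _)); rewrite (@shift_mxE _ i) ?xi //= iE.
Qed.

End RowLength.

(** * A weight that is superharmonic under the shears *)

Section Superharmonic.
Variable R : realFieldType.

(* The ratio 4/5 and the correction 23/25 on the diagonal make the sum of
   [defect x y] and [defect y x] positive: it is at least 7/25 - 1/4 if the
   lengths of [x] and [y] differ, and 2/23 otherwise. *)
Definition weight (a b : nat) : R :=
  (4 / 5) ^+ maxn a b * (if a == b then 23 / 25 else 1).

Lemma weightC a b : weight a b = weight b a.
Proof. by rewrite /weight maxnC eq_sym. Qed.

Lemma weight_gt0 a b : 0 < weight a b.
Proof.
have r45 : 0 < (4 / 5 : R) by lra.
by rewrite /weight; case: ifP => _; rewrite mulr_gt0 ?exprn_gt0 //; lra.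
Qed.

Lemma pow45S n : (4 / 5 : R) ^+ n.+1 = 4 / 5 * (4 / 5) ^+ n.
Proof. exact: exprS. Qed.

(** The worst ratio is 5/4 from the maximum times 25/23 from the diagonal, which is below 2. *)
Lemma weight_ratio_le2 a b c d : (maxn a b <= (maxn c d).+1)%N ->
  weight c d / weight a b <= 2.
Proof.
move=> le; rewrite ler_pdivrMr ?weight_gt0 // /weight.
have le45 : (4 / 5 : R) ^+ (maxn c d).+1 <= (4 / 5) ^+ maxn a b.
  by apply: ler_wiXn2l le; lra.
rewrite pow45S in le45.
have r45 : 0 < (4 / 5 : R) by lra.
have := exprn_gt0 (maxn c d) r45; have := exprn_gt0 (maxn a b) r45.
move: le45; move: ((4 / 5 : R) ^+ maxn c d) ((4 / 5 : R) ^+ maxn a b) => q p le45 p0 q0.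
by case: ifP => _; case: ifP => _; lra.
Qed.

Variable k : nat.
Implicit Types x y : 'rV['F_2]_k.

Definition wt x y := weight (row_len x) (row_len y).

Definition defect x y :=
  (1 - wt (x + y) y / wt x y) + (1 - wt (x + y *m shift_mx k) y / wt x y).

Lemma defect_ge x y : -2 <= defect x y.
Proof.
suff r2 z : (row_len z <= (row_len y).+1)%N -> wt (x + z) y / wt x y <= 2.
  by have := r2 _ (leqnSn _); have := r2 _ (row_len_shift_le y); rewrite /defect; lra.
move=> zy; apply: weight_ratio_le2; have := row_lenD (x + z) z.
by rewrite -addrA F2_mx_addrr addr0; lia.
Qed.

(** Adding the shorter row keeps the length of [x]. Adding its shift can shorten [x] only when the
    shift is exactly as long as [x]; the maximum then drops by one and the ratio is at most 5/4. *)
Lemma defect_lt x y : (row_len y < row_len x)%N ->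
  -1 / 4 <= defect x y.
Proof.
move=> yx; rewrite /defect {1}/wt row_lenD_lt // divff ?gt_eqF ?weight_gt0 //.
suff : wt (x + y *m shift_mx k) y / wt x y <= 5 / 4 by lra.
rewrite /wt; set a := row_len x; set b := row_len y; set c := row_len _.
have : (c = a \/ (c < a /\ b.+1 = a))%N.
  have := row_len_shift_le y; rewrite -/b leq_eqVlt => /orP[/eqP bS|]; last first.
    by move=> bS; left; apply: row_lenD_lt; apply: leq_trans yx.
  have [ba|ba] := eqVneq b.+1 a; last first.
    by left; apply: row_lenD_lt; rewrite bS ltn_neqAle ba.
  right; split=> //; rewrite /c -/a /a row_lenD_eq //.
  - by rewrite bS ba.
  - by move: yx; rewrite -/a; lia.
case=> [->|[ca ba]]; first by rewrite divff ?gt_eqF ?weight_gt0 //; lra.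
rewrite ler_pdivrMr ?weight_gt0 // /weight.
have -> : maxn a b = b.+1 by lia.
have -> : maxn c b = b by lia.
have -> : (a == b) = false by apply/eqP; lia.
rewrite pow45S; have : 0 < (4 / 5 : R) ^+ b by apply: exprn_gt0; lra.
by move: ((4 / 5 : R) ^+ b) => p p0; case: ifP => _; lra.
Qed.

(** Adding the longer row to the shorter one lands on the diagonal and gains 2/25; adding its shift
    raises the maximum and gains 1/5. *)
Lemma defect_gt x y : (row_len y < row_len x)%N -> (row_len x < k)%N ->
  defect y x = 28 / 100.
Proof.
move=> yx xk; have x0 : (0 < row_len x)%N by lia.
have shE := row_len_shift x0 xk.
rewrite /defect /wt [y + x]addrC (row_lenD_lt yx) [y + x *m shift_mx k]addrC.
rewrite row_lenD_lt ?shE; last by lia.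
set a := row_len x in yx *; set b := row_len y in yx *; rewrite /weight.
have -> : maxn b a = a by lia.
have -> : maxn a.+1 a = a.+1 by lia.
rewrite maxnn eqxx; have -> : (b == a) = false by apply/eqP; lia.
have -> : (a.+1 == a) = false by apply/eqP; lia.
rewrite pow45S; have r45 : 0 < (4 / 5 : R) by lra.
have : (4 / 5 : R) ^+ a != 0 by rewrite gt_eqF // exprn_gt0.
by move: ((4 / 5 : R) ^+ a) => p p0; field.
Qed.

(** Adding an equally long row leaves the diagonal and loses 2/23; adding its shift raises the
    maximum and gains 3/23. *)
Lemma defect_eq x y : row_len x = row_len y -> (0 < row_len x)%N ->
  (row_len x < k)%N -> defect x y = 1 / 23.
Proof.
move=> xy x0 xk; have ltS := row_lenD_eq xy x0; rewrite xy in x0 xk.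
have shE := row_len_shift x0 xk.
have shlt : (row_len x < row_len (y *m shift_mx k))%N by rewrite shE xy.
rewrite /defect /wt [x + y *m shift_mx k]addrC (row_lenD_lt shlt) shE.
rewrite xy in ltS *; move: ltS; set a := row_len y; set c := row_len _ => ltS.
rewrite /weight maxnn eqxx; have -> : maxn c a = a by lia.
have -> : maxn a.+1 a = a.+1 by lia.
have -> : (c == a) = false by apply/eqP; lia.
have -> : (a.+1 == a) = false by apply/eqP; lia.
rewrite pow45S; have r45 : 0 < (4 / 5 : R) by lra.
have : (4 / 5 : R) ^+ a != 0 by rewrite gt_eqF // exprn_gt0.
by move: ((4 / 5 : R) ^+ a) => p p0; field.
Qed.

Lemma superharmonic x y : (x, y) != (0, 0) ->
  3 / 100 - 5 * ((row_len x == k) || (row_len y == k))%:R <= defect x y + defect y x.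
Proof.
(* On the boundary the crude bound -2 for each defect suffices, since 3/100 - 5 is below -4. *)
move=> xy0; have [_|] /= := boolP (_ || _).
  by have := defect_ge x y; have := defect_ge y x; lra.
rewrite negb_or !neq_ltn ![(k < _)%N]ltnNge !row_len_max !orbF => /andP[xk yk].
rewrite mulr0 subr0; have [lt|lt|eq] := ltngtP (row_len x) (row_len y).
- by have := defect_lt lt; rewrite (defect_gt lt yk); lra.
- by have := defect_lt lt; rewrite (defect_gt lt xk); lra.
have x0 : (0 < row_len x)%N.
  rewrite lt0n; apply: contra xy0 => x0.
  have : (row_len y == 0)%N by rewrite -eq.
  by move: x0; rewrite !row_len0 => /eqP-> /eqP->.
by rewrite (defect_eq eq x0 xk) (defect_eq (esym eq)) -?eq //; lra.
Qed.

End Superharmonic.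

(** * Shears and translations acting on pairs of rows *)

Section AffineExpander.
Variables (R : realFieldType) (k : nat).
Local Notation A := 'M['F_2]_(2, k.+1).
Implicit Types (u v w : A) (b : bool).

Definition F2_sign (z : 'F_2) : R := if z == 0 then 1 else -1.

Definition pairing_sign w u : R := F2_sign (\tr (w *m u^T)).

(** [E] chooses which row is added to which, and [Q] is applied to the added row. *)
Definition shear (E : 'M['F_2]_2) (Q : 'M['F_2]_k.+1) w : A := w + E *m w *m Q.

Definition row_idx b : 'I_2 := if b then ord0 else ord_max.

Definition shear_dir b : 'M['F_2]_2 := delta_mx (row_idx b) (row_idx (~~ b)).

Definition shear_mult b : 'M['F_2]_k.+1 := if b then shift_mx k.+1 else 1%:M.

(** The transposes make this the adjoint of [dual_shear] for the trace pairing. *)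
Definition primal_shear (i : bool * bool) : A -> A :=
  shear (shear_dir i.1)^T (shear_mult i.2)^T.

Definition dual_shear (i : bool * bool) : A -> A :=
  shear (shear_dir i.1) (shear_mult i.2).

Definition top_unit b : A := delta_mx (row_idx b) ord_max.

Lemma F2_signD y z : F2_sign (y + z) = F2_sign y * F2_sign z.
Proof.
rewrite /F2_sign; have [->|/F2_neq0->] := eqVneq y 0; first by rewrite add0r mul1r.
have [->|/F2_neq0->] := eqVneq z 0; first by rewrite addr0 oner_eq0 mulr1.
by rewrite F2_addrr eqxx mulrNN mulr1.
Qed.

Lemma F2_sign_sqr z : F2_sign z ^+ 2 = 1.
Proof. by rewrite /F2_sign; case: ifP => _; rewrite ?sqrrN expr1n. Qed.

Lemma pairing_signDr w u v :
  pairing_sign w (u + v) = pairing_sign w u * pairing_sign w v.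
Proof. by rewrite /pairing_sign linearD /= mulmxDr mxtraceD F2_signD. Qed.

Lemma pairing_signDl w w' u :
  pairing_sign (w + w') u = pairing_sign w u * pairing_sign w' u.
Proof. by rewrite /pairing_sign mulmxDl mxtraceD F2_signD. Qed.

Lemma pairing_sign0l u : pairing_sign 0 u = 1.
Proof. by rewrite /pairing_sign mul0mx mxtrace0 /F2_sign eqxx. Qed.

Lemma mxtrace_delta u i j : \tr (delta_mx i j *m u^T) = u i j.
Proof.
rewrite /mxtrace (bigD1 i) //= big1 ?addr0.
  by rewrite mxE (bigD1 j) //= !mxE !eqxx mul1r big1 ?addr0 // => l /negPf lj;
    rewrite !mxE lj andbF mul0r.
by move=> l /negPf li; rewrite mxE big1 // => n _; rewrite !mxE li mul0r.
Qed.

Lemma pairing_sign_delta w i j : pairing_sign w (delta_mx i j) = F2_sign (w i j).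
Proof.
rewrite /pairing_sign -mxtrace_tr trmx_mul trmxK mxtrace_delta //.
Qed.

(** For [u] nonzero at [(i, j)], shifting [w] by the matrix unit there flips every sign, so the sum
    equals its opposite. *)
Lemma sum_pairing_sign u : \sum_w pairing_sign w u = #|{: A}|%:R * (u == 0)%:R.
Proof.
have [->|u0] := eqVneq u 0.
  under eq_bigr => w _ do rewrite /pairing_sign trmx0 mulmx0 mxtrace0 /F2_sign eqxx.
  by rewrite sumr_const mulr1.
rewrite mulr0; have [i [j uij]] : exists i, exists j, u i j != 0.
  have [/existsP[i /existsP[j uij]]|] := boolP [exists i, exists j, u i j != 0].
    by exists i, j.
  rewrite negb_exists => /forallP H; case/eqP: u0; apply/matrixP=> i j; rewrite mxE.
  by have := H i; rewrite negb_exists => /forallP/(_ j); rewrite negbK => /eqP.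
have flip : \sum_w pairing_sign w u = - \sum_w pairing_sign w u.
  rewrite {1}(reindex_inj (addrI (delta_mx i j))) -sumrN; apply: eq_bigr => w _ /=.
  by rewrite pairing_signDl {1}/pairing_sign mxtrace_delta /F2_sign (negPf uij) mulN1r.
by move: flip; lra.
Qed.

Lemma shearK E Q : E *m E = 0 -> involutive (shear E Q).
Proof.
move=> EE w; rewrite /shear mulmxDr mulmxDl !mulmxA EE !mul0mx addr0 -addrA.
by rewrite F2_mx_addrr addr0.
Qed.

Lemma shearD E Q u v : shear E Q (u + v) = shear E Q u + shear E Q v.
Proof. by rewrite /shear mulmxDr mulmxDl addrACA. Qed.

Lemma shear_dir_sqr b : shear_dir b *m shear_dir b = 0.
Proof. by rewrite mul_delta_mx_0 //; case: b. Qed.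

Lemma dual_shearK i : involutive (dual_shear i).
Proof. exact/shearK/shear_dir_sqr. Qed.

Lemma primal_shearK i : involutive (primal_shear i).
Proof. by apply: shearK; rewrite -trmx_mul shear_dir_sqr trmx0. Qed.

Lemma pairing_sign_shear i w v :
  pairing_sign w (primal_shear i v) = pairing_sign (dual_shear i w) v.
Proof.
rewrite /pairing_sign /primal_shear /dual_shear /shear linearD /= !trmx_mul !trmxK.
rewrite mulmxDr mulmxDl !mxtraceD; congr (F2_sign (_ + _)).
by rewrite !mulmxA [LHS]mxtrace_mulC !mulmxA.
Qed.

Definition mx_weight w : R := wt R (row (row_idx true) w) (row (row_idx false) w).

Definition on_boundary w :=
  (row_len (row (row_idx true) w) == k.+1) || (row_len (row (row_idx false) w) == k.+1).

Lemma row_dual_shear i w : row (row_idx i.1) (dual_shear i w) =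
  row (row_idx i.1) w + row (row_idx (~~ i.1)) w *m shear_mult i.2.
Proof.
rewrite /dual_shear /shear linearD /= !row_mul; congr (_ + _ *m _).
by rewrite rowE mul_delta_mx -rowE.
Qed.

Lemma row_dual_shear_other i w :
  row (row_idx (~~ i.1)) (dual_shear i w) = row (row_idx (~~ i.1)) w.
Proof.
rewrite /dual_shear /shear linearD /= !row_mul rowE mul_delta_mx_0 ?mul0mx ?addr0 //.
by case: i.1.
Qed.

Lemma sum_bool_pair (F : bool * bool -> R) :
  \sum_i F i = (F (true, false) + F (true, true)) + (F (false, false) + F (false, true)).
Proof.
rewrite (eq_bigr (fun i => F (i.1, i.2))); last by case.
rewrite -(pair_bigA _ (fun b e => F (b, e))) /= big_bool /= !big_bool /=.
by congr (_ + _); rewrite addrC.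
Qed.

Lemma mx_weight_dual_shear i w : mx_weight (dual_shear i w) =
  wt R (row (row_idx i.1) w + row (row_idx (~~ i.1)) w *m shear_mult i.2)
       (row (row_idx (~~ i.1)) w).
Proof.
rewrite -row_dual_shear -[row (row_idx (~~ i.1)) w](row_dual_shear_other i).
by case: i => -[] e; rewrite /mx_weight // /wt weightC.
Qed.

Lemma sum_defect w :
  \sum_i (1 - mx_weight (dual_shear i w) / mx_weight w) =
  defect R (row (row_idx true) w) (row (row_idx false) w) +
  defect R (row (row_idx false) w) (row (row_idx true) w).
Proof.
have half b : defect R (row (row_idx b) w) (row (row_idx (~~ b)) w) =
    (1 - mx_weight (dual_shear (b, false) w) / mx_weight w) +
    (1 - mx_weight (dual_shear (b, true) w) / mx_weight w).
  have -> : mx_weight w = wt R (row (row_idx b) w) (row (row_idx (~~ b)) w).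
    by case: b; rewrite /mx_weight // /wt weightC.
  by rewrite !mx_weight_dual_shear /defect /shear_mult /= mulmx1.
rewrite (sum_bool_pair (fun i => 1 - mx_weight (dual_shear i w) / mx_weight w)).
exact: esym (congr2 +%R (half true) (half false)).
Qed.

Lemma mx_superharmonic w : w != 0 ->
  3 / 100 - 5 * (on_boundary w)%:R <=
  \sum_i (1 - mx_weight (dual_shear i w) / mx_weight w).
Proof.
move=> w0; rewrite sum_defect; apply: superharmonic.
apply: contra w0 => /eqP[w1 w2]; apply/eqP/row_matrixP => i; rewrite row0.
have [->//|i0] := eqVneq i (row_idx true).
suff -> : i = row_idx false by [].
by apply: val_inj; case: i i0 => -[|[|//]].
Qed.

(** A row of full length has last coefficient 1, and pairing with [top_unit] reads off this
    coefficient. *)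
Lemma boundary_top_unit w : on_boundary w -> exists b, pairing_sign w (top_unit b) = -1.
Proof.
have lead b : row_len (row (row_idx b) w) == k.+1 -> pairing_sign w (top_unit b) = -1.
  move=> /eqP/row_len_lead[i ik]; rewrite mxE => wi.
  rewrite pairing_sign_delta /F2_sign (_ : ord_max = i) ?wi ?oner_eq0 //.
  exact: ord_inj.
by case/orP=> /lead; [exists true | exists false].
Qed.

Definition conj_perm (f : A -> A) (fI : injective f) : 'S_#|{: A}| :=
  perm (inj_comp enum_rank_inj (inj_comp fI enum_val_inj)).

Definition translation v : 'S_#|{: A}| := conj_perm (@addIr _ v).

Definition shear_perm i : 'S_#|{: A}| := conj_perm (inv_inj (primal_shearK i)).

Lemma translationD u v : translation (u + v) = (translation u * translation v)%g.
Proof. by apply/permP=> i; rewrite permM !permE /= enum_rankK addrA. Qed.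

Lemma translation_inj : injective translation.
Proof.
move=> u v /permP/(_ (enum_rank 0)); rewrite !permE /= !enum_rankK !add0r.
exact: enum_rank_inj.
Qed.

Lemma shear_perm_translation i v :
  (shear_perm i * translation v = translation (primal_shear i v) * shear_perm i)%g.
Proof.
apply/permP=> j; rewrite !permM !permE /= !enum_rankK; congr enum_rank.
by rewrite /primal_shear shearD -/(primal_shear i _) -/(primal_shear i _) primal_shearK.
Qed.

Lemma affine_poincare (f : 'S_#|{: A}| -> R) :
  \sum_v \sum_g (f (translation v * g)%g - f g) ^+ 2 <=
  200 * #|{: A}|%:R *
    (\sum_i \sum_g (f (shear_perm i * g)%g - f g) ^+ 2 +
     \sum_b \sum_g (f (translation (top_unit b) * g)%g - f g) ^+ 2).
Proof.
have := @walsh_poincare R A pairing_sign pairing_signDr _ sum_pairing_sign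
  pairing_sign0l _ translation translationD _ _ shear_perm primal_shear
  dual_shear top_unit mx_weight on_boundary (3 / 100) 5 f shear_perm_translation
  primal_shearK dual_shearK pairing_sign_shear _ _ _ _ mx_superharmonic boundary_top_unit.
have ge0 (T : finType) (s : T -> 'S_#|{: A}|) :
    0 <= \sum_i \sum_g (f (s i * g)%g - f g) ^+ 2.
  by apply: sumr_ge0 => i _; apply: sumr_ge0 => g _; apply: sqr_ge0.
have := ge0 _ shear_perm; have := ge0 _ (fun b => translation (top_unit b)).
set ES := \sum_i \sum_g (f (shear_perm i * g)%g - f g) ^+ 2.
set EU := \sum_b \sum_g (f (translation (top_unit b) * g)%g - f g) ^+ 2.
set EV := \sum_v \sum_g (f (translation v * g)%g - f g) ^+ 2 => EU0 ES0 H.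
have d0 : 0 <= 3 / 100 :> R by lra.
(* Dividing by 3/100 gives the factors 200/3 and 500/3, both at most 200. *)
have {}H : 3 / 100 * EV <= #|{: A}|%:R * (2 * ES + 5 * EU).
  apply: H => //.
  - by move=> w u; apply: F2_sign_sqr.
  - by move=> w; apply: weight_gt0.
  - by move=> i; rewrite /dual_shear /shear mulmx0 mul0mx addr0.
have N0 : 0 <= #|{: A}|%:R :> R by [].
have := mulr_ge0 N0 ES0; have := mulr_ge0 N0 EU0.
by rewrite mulrDr in H; rewrite mulrDr; lra.
Qed.

End AffineExpander.

(** * Cuts, balls and maps into L1 *)

Section CutPrinciple.
Variables (R : realFieldType) (T P Q : finType) (a b : P -> T) (c d : Q -> T) (C : R).

Let cut_le (f : T -> R) :=
  \sum_p `|f (a p) - f (b p)| <= C * \sum_q `|f (c q) - f (d q)|.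

(* A function with n values is a nonnegative combination of n - 1 indicator
   functions, in such a way that the distances |f x - f y| add up. *)
Lemma cut_principle :
  (forall E : {set T}, cut_le (fun x => (x \in E)%:R)) -> forall f, cut_le f.
Proof.
(* Induction on the number of pairs that [f] orders strictly, which is 0 only for constant [f]. *)
move=> cutE f; have [n] := ubnP #|[set p : T * T | f p.1 < f p.2]|.
elim: n f => // n IH f; rewrite ltnS => fn.
have [x0 /= lt0|P0] := pickP (fun p : T * T => f p.1 < f p.2); last first.
  have const x y : f x = f y.
    by apply/eqP; rewrite eq_le !leNgt (P0 (x, y)) (P0 (y, x)).
  have dist0 x y : `|f x - f y| = 0 by rewrite (const x y) subrr normr0.
  by rewrite /cut_le !big1 ?mulr0 // => p _; apply: dist0.
have [top _ topP] := @Order.TotalTheory.arg_maxP _ _ T x0.1 predT f isT.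
have {}topP x : f x <= f top by apply: topP.
have x0top : f x0.1 < f top by apply: lt_le_trans lt0 (topP x0.2).
(* Lowering the top level set [E] to the second largest value [f snd] splits off the cut of [E] with
   weight [f top - f snd], and the pair [(snd, top)] is no longer strictly ordered. *)
have [snd snd_lt sndP] :=
  @Order.TotalTheory.arg_maxP _ _ T x0.1 (fun x => f x < f top) f x0top.
have {}sndP x : f x < f top -> f x <= f snd by apply: sndP.
pose E := [set x | f x == f top]; pose g x := Num.min (f x) (f snd).
have gE x : g x = if x \in E then f snd else f x.
  rewrite inE /g; case: eqP => [->|/eqP ne]; first by rewrite min_r // ltW.
  by rewrite min_l // sndP // lt_neqAle ne topP.
have outE x : x \notin E -> f x <= f snd.
  by rewrite inE => ne; rewrite sndP // lt_neqAle ne topP.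
have inE' x : x \in E -> f x = f top by rewrite inE => /eqP.
have split x y : `|f x - f y| =
    `|g x - g y| + (f top - f snd) * `|(x \in E)%:R - (y \in E)%:R|.
  rewrite !gE; case: ifPn => xE; case: ifPn => yE.
  - by rewrite (inE' _ xE) (inE' _ yE) !subrr normr0 mulr0 addr0.
  - rewrite (inE' _ xE) subr0 normr1 mulr1.
    by rewrite !ger0_norm ?subr_ge0 ?outE ?topP //; ring.
  - rewrite (inE' _ yE) sub0r normrN normr1 mulr1.
    by rewrite !ler0_norm ?subr_le0 ?outE ?topP //; ring.
  - by rewrite subrr normr0 mulr0 addr0.
have /IH gle : (#|[set p : T * T | (g p.1 < g p.2)%R]| < n)%N.
  apply: leq_trans fn; apply: proper_card; apply/properP; split.
    apply/fintype.subsetP=> p; rewrite !inE; apply: contraTT; rewrite -!leNgt => le.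
    by rewrite le_min !ge_min le lexx orbT.
  by exists (snd, top); rewrite !inE //= !gE !inE eqxx (lt_eqF snd_lt) ltxx.
rewrite /cut_le; under eq_bigr => p _ do rewrite split.
under [X in _ <= C * X]eq_bigr => q _ do rewrite split.
rewrite !big_split -!mulr_sumr mulrDr; apply: lerD; first exact: gle.
by rewrite mulrCA ler_wpM2l ?subr_ge0 ?(ltW snd_lt) //; apply: cutE.
Qed.
End CutPrinciple.

(** * Growth of balls *)

Section WordBall.
Variables (gT : finGroupType) (S : {set gT}).

Fixpoint word_ball (l : nat) : {set gT} :=
  if l is l'.+1 then
    (word_ball l' :|: S * word_ball l' :|: S^-1 * word_ball l')%g
  else [set 1%g].

Lemma card_mulg_le (B D : {set gT}) : (#|(B * D)%g| <= #|B| * #|D|)%N.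
Proof.
rewrite -cardsX; have -> : (B * D)%g = (fun p => p.1 * p.2)%g @: finset.setX B D.
  apply/finset.setP=> x; apply/mulsgP/imsetP => [[y z yB zD ->]|[[y z]]].
    by exists (y, z); rewrite ?inE ?yB.
  by rewrite inE => /andP[yB zD] ->; exists y z.
exact: leq_imset_card.
Qed.

Lemma card_word_ball l : (#|word_ball l| <= (2 * #|S| + 1) ^ l)%N.
Proof.
elim: l => [|l IH]; first by rewrite cards1.
rewrite /= expnS; apply: leq_trans (leq_mul (leqnn _) IH).
set B := word_ball l.
apply: (@leq_trans (#|B| + #|S| * #|B| + #|S| * #|B|)%N).
2: by rewrite mulnDl mul1n -mulnA mul2n -addnn [leqRHS]addnC addnA.
apply: leq_trans (leq_card_setU _ _) _; apply: leq_add; last first.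
  by apply: leq_trans (card_mulg_le _ _) _; rewrite card_invg.
by apply: leq_trans (leq_card_setU _ _) _; rewrite leq_add2l card_mulg_le.
Qed.

Lemma word_ball_step l x y :
  x \in word_ball l -> cayley_edge S x y -> y \in word_ball l.+1.
Proof.
move=> xl /existsP[s /andP[sS /orP[/eqP->|/eqP xE]]] /=; rewrite !inE.
  by rewrite mem_mulg ?orbT.
apply/orP; right; have -> : y = (s^-1 * x)%g by rewrite xE mulKg.
by apply: mem_mulg => //; rewrite memV_invg.
Qed.

Lemma reach_word_ball l x : reach S l 1%g x -> x \in word_ball l.
Proof.
have mono l1 l2 : (l1 <= l2)%N -> word_ball l1 \subset word_ball l2.
  move/subnKC <-; elim: (l2 - l1)%N => [|i IH]; first by rewrite addn0.
  rewrite addnS; apply: fintype.subset_trans IH _.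
  by rewrite /= -finset.setUA finset.subsetUl.
move=> [p [p1 <- pl]]; apply: (fintype.subsetP (mono _ _ pl)).
have : 1%g \in word_ball 0 by rewrite inE.
rewrite -[size p]add0n; elim: p 1%g 0%N p1 {pl} => [|y p IH] z i /=.
  by rewrite addn0.
by case/andP=> zy yp zi; rewrite addnS -addSn; apply: IH => //; apply: word_ball_step zy.
Qed.

End WordBall.

Import numFieldNormedType.Exports.
Local Open Scope classical_set_scope.

(** * Distances in L1 as integrals *)

Section L1Space.
Variable R : realType.
Local Notation mu := (@mu01 R).
Local Notation RT := (measurableTypeR R).

Lemma L1_distE (f g : L1 R) :
  L1_dist f g = (\int[mu]_t `|(f t - g t)%:E|)%E.
Proof. by rewrite /L1_dist Lnorm1. Qed.

Lemma measurable_abs_sub (f g : RT -> R) :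
  measurable_fun setT f -> measurable_fun setT g ->
  measurable_fun [set: RT] (fun t : RT => `|(f t - g t)%:E|%E : \bar R).
Proof.
move=> mf mg; apply: measurableT_comp => //; apply/measurable_EFinP.
exact: measurable_funB.
Qed.

(* [RT] and [R] carry the same sigma-algebra with different displays. *)
Lemma measurable_mfun_RT (f : {mfun RT >-> RT}) :
  measurable_fun [set: RT] (f : RT -> R).
Proof.
move=> mT Y mY; have mY' : @measurable _ RT Y by exact: mY.
have := @measurable_funP _ _ RT RT setT f mT Y mY'; exact.
Qed.

Lemma measurable_L1 (f : L1 R) : measurable_fun [set: RT] (f : RT -> R).
Proof. exact: measurable_mfun_RT. Qed.

(** The canonical representative of the class of [f] equals [f] almost everywhere and so inherits
    its finite norm. *)
Lemma L1_representative (f : RT -> R) : measurable_fun setT f ->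
  (\int[mu]_t `|(f t)%:E| < +oo)%E ->
  exists F : L1 R, ae_eq mu setT (F : RT -> R) f.
Proof.
move=> mf intf.
have fm : f \in @mfun _ _ RT RT by rewrite inE => mT Y mY; exact: (mf mT Y mY).
pose f1 : {mfun RT >-> RT} := @mfun_Sub _ _ RT RT f fm.
pose F1 : {mfun_ mu, RT >-> RT} := (\pi_({mfun_ mu, RT >-> RT}) f1)%qT.
have F1f : ae_eq mu setT (F1 : RT -> R) f.
  have : ae_eq_op mu (generic_quotient.repr F1) f1 by rewrite -eqmodE reprK.
  by move/asboolP => H; exact: H.
have mF1 : measurable_fun setT (F1 : RT -> R).
  exact: measurable_mfun_RT.
have finF : finite_norm mu 1 F1.
  rewrite /finite_norm Lnorm1.
  rewrite (@ae_eq_integral _ _ _ mu setT (fun t => `|(f t)%:E|%E)) //.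
  - apply: measurableT_comp => //; exact/measurable_EFinP.
  - apply: measurableT_comp => //; exact/measurable_EFinP.
  - by apply: filterS F1f => t H /H /= ->.
exists (HB.pack_for (LspaceType mu (@lexx _ _ 1%E)) F1
  (@isFinLebesgue.Build _ RT R mu 1%E (@lexx _ _ 1%E) F1 finF)).
exact: F1f.
Qed.
Section StepFunctions.
Variable I : finType.
Local Notation N := (#|I|%:R : R).
Implicit Types (i j : I) (a b : I -> R).

Definition cell i : set RT :=
  [set` `[(enum_rank i)%:R / N, (enum_rank i).+1%:R / N[%R].

(** The factor [N] offsets the length [1/N] of a cell, which makes the map from finite ell1 to L1
    isometric. *)
Definition step a (t : RT) : R := \sum_i a i * N * \1_(cell i) t.

Lemma card_gt0 i : 0 < N.
Proof. by rewrite ltr0n; apply/card_gt0P; exists i. Qed.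

Lemma cellP i (t : RT) : cell i t <-> (enum_rank i)%:R <= t * N < (enum_rank i).+1%:R.
Proof.
by rewrite /cell /= in_itv /= ler_pdivrMr ?ltr_pdivlMr //; apply: card_gt0 i.
Qed.

Lemma cell_unique i j (t : RT) : cell i t -> cell j t -> i = j.
Proof.
move=> /cellP/andP[i1 i2] /cellP/andP[j1 j2]; apply/enum_rank_inj/ord_inj.
have := le_lt_trans i1 j2; have := le_lt_trans j1 i2; rewrite !ltr_nat.
by move=> ? ?; apply/eqP; rewrite eqn_leq -ltnS -[X in _ && X]ltnS; apply/andP.
Qed.

Lemma measurable_cell i : @measurable _ RT (cell i).
Proof. exact: measurable_itv. Qed.

Lemma mu_cell i : mu (cell i) = (N^-1)%:E.
Proof.
have N0 := card_gt0 i.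
rewrite -[LHS]/(lebesgue_measure (cell i `&` [set` `[0, 1]%R])) setIidl; last first.
  move=> t /cellP/andP[t0 t1]; rewrite /= in_itv /=; apply/andP; split.
    by rewrite -(pmulr_lge0 _ N0); apply: le_trans t0.
  rewrite -(ler_pM2r N0) mul1r; apply: ltW; apply: lt_le_trans t1 _.
  by rewrite ler_nat ltn_ord.
rewrite lebesgue_measure_itv /= lte_fin ltr_pM2r ?invr_gt0 // ltr_nat ltnSn.
by rewrite -EFinB -mulrBl -natrB ?leqnSn // subSnn mul1r.
Qed.

Lemma norm_stepB a b (t : RT) :
  `|step a t - step b t| = \sum_i `|a i - b i| * N * \1_(cell i) t.
Proof.
rewrite /step -sumrB.
have [[i it]|no] := pselect (exists i, cell i t); last first.
  have ind0 i : \1_(cell i) t = 0 :> R.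
    by rewrite indicE memNset // => it; apply: no; exists i.
  by rewrite !big1 ?normr0 // => i _; rewrite ind0 !mulr0 ?subrr.
have ind0 j : j != i -> \1_(cell j) t = 0 :> R.
  by move=> ji; rewrite indicE memNset // => jt; rewrite (cell_unique jt it) eqxx in ji.
have ind1 : \1_(cell i) t = 1 :> R by rewrite indicE mem_set.
rewrite (bigD1 i) //= [RHS](bigD1 i) //= ind1 !mulr1 !big1 ?addr0.
- by rewrite -mulrBl normrM [`|N|]ger0_norm.
- by move=> j ji; rewrite ind0 // mulr0.
- by move=> j ji; rewrite ind0 // !mulr0 subrr.
Qed.

Lemma measurable_step a : measurable_fun [set: RT] (step a).
Proof.
apply: measurable_sum => i; apply: measurable_funM => //.
by apply: measurable_indic; apply: measurable_cell.
Qed.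

Lemma integral_stepB a b :
  (\int[mu]_t `|(step a t - step b t)%:E|)%E = (\sum_i `|a i - b i|)%:E.
Proof.
transitivity (\int[mu]_t (\sum_i (`|a i - b i| * N)%:E * (\1_(cell i) t)%:E))%E.
  apply: eq_integral => t _; rewrite -[LHS]/(`|step a t - step b t|%:E) norm_stepB.
  by rewrite -sumEFin; apply: eq_bigr => i _; rewrite EFinM.
have mind i : measurable_fun [set: RT] (fun t : RT => (\1_(cell i) t)%:E : \bar R).
  by apply/measurable_EFinP; apply: measurable_indic; apply: measurable_cell.
rewrite ge0_integral_sum //.
- rewrite -sumEFin; apply: eq_bigr => i _; rewrite ge0_integralZl //.
  rewrite integral_indic // ?setIT; last exact: measurable_cell.
  by rewrite mu_cell -EFinM mulfK // gt_eqF // (card_gt0 i).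
- by move=> i; apply: measurable_funeM.
Qed.

Lemma ell1_embeds_L1 (T : Type) (phi : T -> I -> R) :
  exists F : T -> L1 R, forall x y,
    L1_dist (F x) (F y) = (\sum_i `|phi x i - phi y i|)%:E.
Proof.
have rep x : exists F : L1 R, ae_eq mu setT (F : RT -> R) (step (phi x)).
  apply: L1_representative; first exact: measurable_step.
  have step0 t : step (fun=> 0) t = 0 by rewrite /step big1 // => i _; rewrite !mul0r.
  under eq_integral => t _ do rewrite -[step _ t]subr0 -(step0 t).
  by rewrite integral_stepB ltry.
have [F FP] := choice rep; exists F => x y; rewrite L1_distE -integral_stepB.
apply: ae_eq_integral => //.
- by apply: measurable_abs_sub; apply: measurable_L1.
- by apply: measurable_abs_sub; apply: measurable_step.
- by apply: filterS2 (FP x) (FP y) => t /= Fx Fy tT; rewrite Fx // Fy.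
Qed.

End StepFunctions.

(** The inequality for real functions applies to [F x t] for each fixed [t] and is then
    integrated. *)
Lemma L1_dist_sum_le (G P Q : finType) (a b : P -> G) (c d : Q -> G) (C : R) :
  0 <= C ->
  (forall f : G -> R,
    \sum_p `|f (a p) - f (b p)| <= C * \sum_q `|f (c q) - f (d q)|) ->
  forall F : G -> L1 R,
    (\sum_p L1_dist (F (a p)) (F (b p)) <=
     C%:E * \sum_q L1_dist (F (c q)) (F (d q)))%E.
Proof.
move=> C0 le F; under eq_bigr => p _ do rewrite L1_distE.
under [X in (_ <= _ * X)%E]eq_bigr => q _ do rewrite L1_distE.
have mF x y : measurable_fun [set: RT] (fun t : RT => `|(F x t - F y t)%:E|%E : \bar R).
  by apply: measurable_abs_sub; apply: measurable_L1.
rewrite -ge0_integral_sum // -ge0_integral_sum // -ge0_integralZl //; last first.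
- by move=> t _; apply: sume_ge0.
- exact: emeasurable_sum.
apply: ge0_le_integral => //.
- by move=> t _; apply: sume_ge0.
- exact: emeasurable_sum.
- by apply: measurable_funeM; exact: emeasurable_sum.
move=> t _; have := le (fun x => F x t).
by rewrite -lee_fin EFinM -!sumEFin.
Qed.

End L1Space.

(** * Distortion of the two families of word metrics *)

Section WordMetric.
Variables (R : realType) (gT : finGroupType) (S : {set gT}).
Implicit Types (x y z : gT) (n : nat).
Local Notation d := (word_metric R S).

Lemma word_metric_le n x y : reach S n x y -> d x y <= n%:R.
Proof.
move=> [p [xp yE pn]]; apply: (@le_trans _ _ (size p)%:R); last by rewrite ler_nat.
by apply: ge_inf; [exists 0 => _ [q _ <-] | exists p].
Qed.

(** The [reach] hypothesis makes the set of path lengths nonempty, so that its infimum is not the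
    default value 0. *)
Lemma word_metric_ge c n x y : reach S n x y ->
  (forall p, path (cayley_edge S) x p -> last x p = y -> c <= (size p)%:R) ->
  c <= d x y.
Proof.
move=> [p [xp yE _]] le; apply: lb_le_inf; first by exists (size p)%:R; exists p.
by move=> _ [q [xq qy] <-]; apply: le.
Qed.

End WordMetric.

Lemma c1_le (R : realType) (M : Type) (d : M -> M -> R) (D : R) (F : M -> L1 R) :
  1 < D ->
  (forall x y, ((d x y)%:E <= L1_dist (F x) (F y) /\
                L1_dist (F x) (F y) <= (D * d x y)%:E)%E) ->
  (c1 d <= D%:E)%E.
Proof.
by move=> D1 FP; apply: ereal_inf_lbound; exists D => //; split=> //; exists F.
Qed.

Lemma c1_ge (R : realType) (M : Type) (d : M -> M -> R) (c : R) :
  (forall (D : R) (F : M -> L1 R), 1 < D ->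
    (forall x y, ((d x y)%:E <= L1_dist (F x) (F y) /\
                  L1_dist (F x) (F y) <= (D * d x y)%:E)%E) -> c <= D) ->
  (c%:E <= c1 d)%E.
Proof.
move=> le; apply: le_ereal_inf_tmp => _ [D [D1 [F FP]] <-].
by rewrite lee_fin; apply: le FP.
Qed.

Section CyclicUpperBound.
Variables (R : realType) (m : nat).
Local Notation G := 'S_m.+1.
Local Notation I := 'I_m.+1.
Implicit Types (g h : G).

Lemma card_cyclic_gens : (#|cyclic_gens m| <= 2)%N.
Proof. by rewrite cards2; case: eqP. Qed.

Lemma key_distC g h : key_dist g h = key_dist h g.
Proof. by apply: eq_bigr => j _; apply: eq_bigr => q _; rewrite eq_sym. Qed.

Lemma key_dist_triangle g h f : (key_dist g f <= key_dist g h + key_dist h f)%N.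
Proof.
rewrite /key_dist -big_split; apply: leq_sum => j _.
rewrite /key_dist_at -big_split; apply: leq_sum => q _ /=.
have [->|_] := eqVneq (key j q g) (key j q h); first exact: leq_addl.
exact: leq_trans (leq_b1 _) (leq_addr _ _).
Qed.

Lemma key_dist_edge g h : cayley_edge (cyclic_gens m) g h ->
  (key_dist g h <= 11 * m.+1)%N.
Proof.
have gen s x : s \in cyclic_gens m -> (key_dist x (s * x)%g <= 11 * m.+1)%N.
  rewrite !inE => /orP[]/eqP->; last exact: key_dist_swap.
  by apply: leq_trans (key_dist_rotation x) _; rewrite leq_mul2r orbT.
move=> /existsP[s /andP[sS /orP[]/eqP->]]; first exact: gen.
by rewrite key_distC; apply: gen.
Qed.

Lemma key_dist_path g p : path (cayley_edge (cyclic_gens m)) g p ->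
  (key_dist g (last g p) <= 11 * m.+1 * size p)%N.
Proof.
elim: p g => [|h p IH] g /=; first by rewrite muln0 /key_dist big1 // => j _;
  rewrite /key_dist_at big1 // => q _; rewrite eqxx.
case/andP=> gh /IH hp; apply: leq_trans (key_dist_triangle _ h _) _.
by rewrite mulnS leq_add // key_dist_edge.
Qed.

Lemma c1_cyclic_gens : (c1 (word_metric R (cyclic_gens m)) <= 44%:E)%E.
Proof.
pose K := option {ffun I -> option I}.
(* One coordinate per possible value of each key: two different values disagree in two coordinates,
   each by [2 / m.+1]. *)
pose phi g (x : I * (I + I + I * I) * K) : R :=
  2 / m.+1%:R * (key x.1.1 x.1.2 g == x.2)%:R.
have m0 : 0 < m.+1%:R :> R by rewrite ltr0n.
have phiE g h : \sum_x `|phi g x - phi h x| = 4 / m.+1%:R * (key_dist g h)%:R.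
  rewrite -(pair_bigA _ (fun x r => `|phi g (x, r) - phi h (x, r)|)) /=.
  rewrite -(pair_bigA _ (fun j q => \sum_r `|phi g (j, q, r) - phi h (j, q, r)|)) /=.
  rewrite /key_dist natr_sum mulr_sumr; apply: eq_bigr => j _.
  rewrite /key_dist_at natr_sum mulr_sumr; apply: eq_bigr => q _.
  rewrite /phi /=; have [->|ne] := eqVneq (key j q g) (key j q h).
    by rewrite mulr0 big1 // => r _; rewrite subrr normr0.
  move: (key j q g) (key j q h) ne => a b ne.
  have ab : (a == b) = false by apply/negbTE.
  have ba : (b == a) = false by rewrite eq_sym.
  rewrite (bigD1 a) // (bigD1 b) /= ?ba // !eqxx ab big1 => [|r /andP[ra rb]].
    rewrite !mulr0 !mulr1 subr0 sub0r normrN addr0 ger0_norm; last first.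
      by rewrite divr_ge0 // ltW.
    by rewrite -mulrDl -natrD.
  by rewrite eq_sym (negPf ra) [b == r]eq_sym (negPf rb) subrr normr0.
have [F FP] := ell1_embeds_L1 phi.
apply: (@c1_le _ _ _ 44 F) => [|g h]; first by rewrite ltr1n.
have [n [reach_n le_n]] := reach_key_dist g h; rewrite FP phiE !lee_fin; split.
  apply: le_trans (word_metric_le R reach_n) _.
  by rewrite mulrAC ler_pdivlMr // mulrC -!natrM ler_nat.
rewrite -ler_pdivrMl //; apply: word_metric_ge reach_n _ => p gp <-.
rewrite ler_pdivrMl // mulrAC ler_pdivrMr // -!natrM ler_nat.
rewrite -[44%N]/(4 * 11)%N -!mulnA leq_mul2l /= [(size p * _)%N]mulnC mulnA.
exact: key_dist_path.
Qed.

End CyclicUpperBound.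

(** [W] is the sum of all translation distances, [B] counts far translations, [G] is the group
    order, [D] the distortion. The constant is 2400 = 2 * 200 * 6. *)
Lemma average_distance_arith (R : realFieldType) (W N B G D L : R) :
  0 <= L -> 0 <= G -> L * (B * G) <= W -> W <= 200 * N * (6 * G * D) -> N <= 2 * B ->
  L * (N * G) <= D * 2400 * (N * G).
Proof.
move=> L0 G0 lower upper far.
by have := ler_wpM2l (mulr_ge0 L0 G0) far; lra.
Qed.

Section ExpanderLowerBound.
Variables (R : realType) (k : nat).
Local Notation A := 'M['F_2]_(2, k.+1).
Local Notation G := 'S_#|{: A}|.
Local Notation N := (#|{: A}|%:R : R).
Local Notation gen_idx := (bool * bool + bool)%type.

Definition expander_gen (i : gen_idx) : G :=
  match i with inl s => shear_perm k s | inr b => translation (top_unit k b) end.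

(** For an indicator function absolute differences are their own squares, so the Poincare inequality
    is the cut case. *)
Lemma expander_cut_le (f : G -> R) :
  \sum_(p : A * G) `|f p.2 - f (translation p.1 * p.2)%g| <=
  200 * N * \sum_(q : gen_idx * G) `|f q.2 - f (expander_gen q.1 * q.2)%g|.
Proof.
apply: (@cut_principle R _ (A * G)%type (gen_idx * G)%type snd
  (fun p => translation p.1 * p.2)%g snd (fun q => expander_gen q.1 * q.2)%g) => E.
have absE (x y : G) :
    `|(x \in E)%:R - (y \in E)%:R| = ((y \in E)%:R - (x \in E)%:R) ^+ 2 :> R.
  by case: (x \in E); case: (y \in E); rewrite /= ?subrr ?subr0 ?sub0r ?normrN
    ?normr1 ?normr0 ?sqrrN ?expr1n ?expr0n.
under eq_bigr => p _ do rewrite absE.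
under [X in _ <= _ * X]eq_bigr => q _ do rewrite absE.
rewrite -(pair_bigA _ (fun v g =>
  ((translation v * g \in E)%g%:R - (g \in E)%:R : R) ^+ 2)) /=.
rewrite -(pair_bigA _ (fun i g =>
  ((expander_gen i * g \in E)%g%:R - (g \in E)%:R : R) ^+ 2)) /=.
rewrite big_sumType /=.
exact: (affine_poincare (fun g => (g \in E)%:R)).
Qed.

Variables (S : {set G}) (L : nat).
Hypothesis gen_in : forall i, expander_gen i \in S.
Hypothesis connected : forall x y, exists n, reach S n x y.
Hypothesis small_ball : (2 * #|word_ball S L| <= #|{: A}|)%N.
Local Notation d := (word_metric R S).

Lemma many_far_translations :
  (#|{: A}| <= 2 * #|[set v : A | translation v \notin word_ball S L]%SET|)%N.
Proof.
set B := [set v | _]%SET.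
have : (#|~: B| <= #|word_ball S L|)%N.
  rewrite -(card_imset _ (@translation_inj k)); apply: subset_leq_card.
  by apply/fintype.subsetP=> _ /imsetP[v + ->]; rewrite !inE negbK.
have arith x y z t : (y <= z -> 2 * z <= t -> x + y = t -> t <= 2 * x)%N by lia.
by move=> le; apply: arith le small_ball (cardsC B).
Qed.

Lemma far_translation v g : translation v \notin word_ball S L ->
  L%:R <= d g (translation v * g)%g.
Proof.
move=> far; have [n reach_n] := connected g (translation v * g)%g.
apply: word_metric_ge reach_n _ => p gp plast; rewrite ler_nat leqNgt.
apply: contra far => pL; apply: reach_word_ball; apply: reachW (ltnW pL) _.
have : reach S (size p) g (translation v * g)%g by exists p.
by move/(reachM g^-1%g); rewrite mulgV mulgK.
Qed.

Lemma expander_c1_ge : ((L%:R / 2400)%:E <= c1 d)%E.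
Proof.
apply: c1_ge => D F D1 FP; have D0 : 0 <= D by apply: ltW; apply: lt_trans D1.
have NG0 : 0 < N * #|G|%:R.
  rewrite -natrM ltr0n muln_gt0; apply/andP; split; apply/card_gt0P.
    by exists 0.
  by exists 1%g.
pose W := \sum_(p : A * G) d p.2 (translation p.1 * p.2)%g.
have upper : W <= 200 * N * (6 * #|G|%:R * D).
  have N0 : 0 <= 200 * N by apply: mulr_ge0; apply: ler0n.
  have le := L1_dist_sum_le N0 expander_cut_le F; rewrite -lee_fin.
  apply: (@le_trans _ _ (\sum_(p : A * G)
      L1_dist (F p.2) (F (translation p.1 * p.2)%g))%E).
    by rewrite /W -sumEFin; apply: lee_sum => p _; exact: (FP _ _).1.
  apply: (le_trans le); rewrite [leRHS]EFinM.
  apply: lee_wpmul2l; first by rewrite lee_fin.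
  (* A generator moves every point by at most 1, hence its image by at most [D]; four shears and two
     translations give the 6. *)
  apply: (@le_trans _ _ (\sum_(q : gen_idx * G) D%:E)%E).
    apply: lee_sum => q _; apply: le_trans (FP _ _).2 _.
    rewrite lee_fin -[leRHS]mulr1 ler_wpM2l //.
    apply: (@word_metric_le _ _ _ 1); apply: reach_edge; apply: cayley_edge_gen.
    exact: gen_in.
  rewrite sumEFin lee_fin sumr_const card_prod card_sum card_prod !card_bool.
  by rewrite -[leLHS]mulr_natl natrM.
pose B := [set v : A | translation v \notin word_ball S L]%SET.
have lower : L%:R * (#|B|%:R * #|G|%:R) <= W.
  rewrite /W -(pair_bigA _ (fun v g => d g (translation v * g)%g)) /=.
  apply: (@le_trans _ _ (\sum_(v in B) \sum_(g : G) L%:R)).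
    by rewrite !sumr_const -mulrnA -[leRHS]mulr_natr natrM [X in _ <= _ * X]mulrC.
  rewrite [leRHS](bigID (mem B)) /= -[leLHS]addr0; apply: lerD.
    apply: ler_sum => v vB; apply: ler_sum => g _; apply: far_translation.
    by move: vB; rewrite finset.inE.
  apply: sumr_ge0 => v _; apply: sumr_ge0 => g _.
  have [n reach_n] := connected g (translation v * g)%g.
  exact: word_metric_ge reach_n _.
have far : N <= 2 * #|B|%:R by rewrite -natrM ler_nat many_far_translations.
have pos2400 : 0 < 2400 :> R by rewrite ltr0n.
rewrite (ler_pdivrMr _ _ pos2400) -(ler_pM2r NG0).
by apply: average_distance_arith lower upper far.
Qed.
End ExpanderLowerBound.

Section MixedGenerators.
Variable R : realType.

Lemma reach_subset (gT : finGroupType) (S S' : {set gT}) n x y :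
  S \subset S' -> reach S n x y -> reach S' n x y.
Proof.
move=> sub [p [xp yE pn]]; exists p; split=> //; apply: sub_path xp => g h.
case/existsP=> s /andP[/(fintype.subsetP sub) sS' gh].
by apply/existsP; exists s; rewrite sS'.
Qed.

Lemma reach_generates (gT : finGroupType) (S : {set gT}) :
  (forall x y, exists n, reach S n x y) -> <<S>>%g = [set: gT]%SET.
Proof.
move=> connected; apply/finset.setP => g; rewrite finset.inE.
by have [n /reach_mem_gen] := connected 1%g g.
Qed.

Definition cyclic_gens_at n : {set 'S_n} :=
  if n is m.+1 return {set 'S_n} then cyclic_gens m else finset.set0.

Lemma card_cyclic_gens_at n : (#|cyclic_gens_at n| <= 2)%N.
Proof. by case: n => [|m]; [rewrite cards0 | apply: card_cyclic_gens]. Qed.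

Lemma cyclic_gens_at_connected n : (0 < n)%N ->
  forall x y, exists l, reach (cyclic_gens_at n) l x y.
Proof. by case: n => // m _ x y; have [l [xy _]] := reach_key_dist x y; exists l. Qed.

(* The size is chosen so that [#|A l| = 64 ^ l.+1] exceeds twice the bound
   [17 ^ l.+1] on the balls of radius [l.+1]. *)
Local Notation A l := 'M['F_2]_(2, (3 * l + 2).+1).

Lemma card_affine l : #|{: A l}| = (64 ^ l.+1)%N.
Proof. by rewrite card_mx card_Fp // (_ : (2 * _ = 6 * l.+1)%N) ?expnM //; lia. Qed.

Lemma exists_distorted_gens l : exists S : {set 'S_#|{: A l}|},
  [/\ forall x y, exists n, reach S n x y, (#|S| <= 8)%N &
      ((l.+1%:R / 2400)%:E <= c1 (word_metric R S))%E].
Proof.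
pose E := [set expander_gen (3 * l + 2) i | i in [set: bool * bool + bool]%SET]%SET.
pose S := (cyclic_gens_at #|{: A l}| :|: E)%SET; exists S.
have cardS : (#|S| <= 8)%N.
  apply: leq_trans (leq_card_setU _ _) _; apply: (@leq_add _ _ 2 6).
    exact: card_cyclic_gens_at.
  apply: leq_trans (leq_imset_card _ _) _.
  by rewrite cardsT card_sum card_prod !card_bool.
(* The cyclic generators are included in [S] to make it connected. *)
have connected x y : exists n, reach S n x y.
  have [|n xy] := @cyclic_gens_at_connected #|{: A l}| _ x y.
    by rewrite card_affine expn_gt0.
  by exists n; apply: reach_subset xy; apply: finset.subsetUl.
split=> //; apply: expander_c1_ge => // [i|].
  by rewrite finset.inE imset_f ?orbT.
(* With at most 8 generators a ball grows by a factor of at most 17 = 2 * 8 + 1 per step, and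
   [2 * 17 ^ l.+1 <= 34 ^ l.+1 <= 64 ^ l.+1]. *)
rewrite [leqRHS]card_affine; apply: (@leq_trans (2 * 17 ^ l.+1)%N).
  rewrite leq_mul2l; apply: leq_trans (card_word_ball _ _) _; rewrite leq_exp2r //.
  by rewrite -[17%N]/(2 * 8 + 1)%N leq_add2r leq_mul2l.
apply: (@leq_trans (34 ^ l.+1)%N); last by rewrite leq_exp2r.
by rewrite -[34%N]/(2 * 17)%N expnMn leq_mul2r (@leq_pexp2l 2 1) ?orbT.
Qed.

Lemma exists_mixed_gens n : exists S : {set 'S_n},
  [/\ (0 < n)%N -> <<S>>%g = [set: 'S_n]%SET, (#|S| <= 8)%N &
      forall l, n = #|{: A l}| -> ((l.+1%:R / 2400)%:E <= c1 (word_metric R S))%E].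
Proof.
have [[l ->]|no] := pselect (exists l, n = #|{: A l}|).
  have [S [connected cardS big]] := exists_distorted_gens l; exists S; split=> //.
    by move=> _; apply: reach_generates.
  move=> l' ll'; suff <- : l = l' by [].
  by move: ll'; rewrite !card_affine => /eqP; rewrite eqn_exp2l // => /eqP[].
exists (cyclic_gens_at n); split.
- by move=> n0; apply: reach_generates; apply: cyclic_gens_at_connected.
- exact: leq_trans (card_cyclic_gens_at n) _.
- by move=> l nE; case: no; exists l.
Qed.

Lemma ereal_sup_bounded (I : Type) (f : I -> \bar R) (P : set I) (B : R) :
  (forall i, P i -> (f i <= B%:E)%E) -> (ereal_sup [set f i | i in P] < +oo)%E.
Proof.
move=> le; apply: (@le_lt_trans _ _ B%:E); last exact: ltry.
by apply: ge_ereal_sup => _ [i Pi <-]; apply: le.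
Qed.

End MixedGenerators.

Local Open Scope ring_scope.

Theorem mainTheorem2 (R : realType) :
  exists S S' : forall n : nat, {set 'S_n},
    [/\ forall n : nat, (1 <= n)%N ->
          <<S n>>%g = [set: 'S_n]%SET /\ <<S' n>>%g = [set: 'S_n]%SET,
        (ereal_sup [set (#|S n|%:R : R)%:E | n in [set n | (1 <= n)%N]]
           < +oo)%E,
        (ereal_sup [set (#|S' n|%:R : R)%:E | n in [set n | (1 <= n)%N]]
           < +oo)%E,
        (ereal_sup [set c1 (word_metric R (S n)) | n in [set n | (1 <= n)%N]]
           < +oo)%E
      & ereal_sup [set c1 (word_metric R (S' n)) | n in [set n | (1 <= n)%N]]
           = +oo%E].
Proof.
pose S' n := projT1 (cid (exists_mixed_gens R n)).
have S'P n := projT2 (cid (exists_mixed_gens R n)); rewrite -/(S' _) in S'P.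
exists cyclic_gens_at, S'; split.
- move=> n n0; have [gen _ _] := S'P n; split; last exact: gen.
  exact/reach_generates/cyclic_gens_at_connected.
- apply: (@ereal_sup_bounded _ _ _ _ 2%:R) => n _.
  by rewrite lee_fin ler_nat card_cyclic_gens_at.
- apply: (@ereal_sup_bounded _ _ _ _ 8%:R) => n _.
  by rewrite lee_fin ler_nat; have [] := S'P n.
- apply: (@ereal_sup_bounded _ _ _ _ 44) => -[//|m] _.
  exact: c1_cyclic_gens.
(* By the Archimedean property the lower bound [l.+1 / 2400] exceeds the given [B] for this [l]. *)
- apply/eqyP => B B0; pose l := Num.bound (B * 2400).
  apply: (@le_trans _ _ (l.+1%:R / 2400)%:E).
    rewrite lee_fin ler_pdivlMr ?ltr0n // ltW //.
    have B2 : 0 <= B * 2400 by rewrite mulr_ge0 ?ler0n // ltW.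
    by apply: lt_le_trans (archi_boundP B2) _; rewrite ler_nat.
  apply: le_ereal_sup_tmp.
  exists (c1 (word_metric R (S' #|{: 'M['F_2]_(2, (3 * l + 2).+1)}|))).
    by exists #|{: 'M['F_2]_(2, (3 * l + 2).+1)}| => //=; rewrite card_affine expn_gt0.
  by have [_ _ /(_ l erefl)] := S'P #|{: 'M['F_2]_(2, (3 * l + 2).+1)}|.
Qed.
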